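(* Let $T\in\mathrm{ITM}(r)$, $r\ge2$. Let $J_0,J_1,\dots,J_n$ be intervals contained in $X=X(T)$ with pairwise disjoint orbits, where $J_0$ is a component interval of $X$ and $J_1,\dots,J_n$ are maximal periodic intervals. Assume that the boundary points of $J_0,\dots,J_n$ land on discontinuities of $T$ before returning, and that each of $a_j^{0,+}$ ($0\le j\le N_0-1$) and $a_j^{0,-}$ ($1\le j\le N_0$) lands on at least two discontinuities before returning to $J_0$. Let $\mathcal C_{\neg X}$ be the set of all (signed) discontinuities in $\mathcal C_1$ that are not contained in $X$. Suppose there are real coefficients - $\alpha_j^0$ for $0\le j\le N_0$; $\alpha_j^{0,+}$ and $\alpha^{0,+}(j,k)$ for $0\le j\le N_0-1$, $1\le k\le m_j^{0,+}-1$; $\alpha_j^{0,-}$ and $\alpha^{0,-}(j,k)$ for $1\le j\le N_0$, $1\le k\le m_j^{0,-}-1$; - $\alpha^{i,+}(0,k)$ for $1\le i\le n$, $1\le k\le m_0^{i,+}$; $\alpha^{i,-}(1,k)$ for $1\le i\le n$, $1\le k\le m_1^{i,-}$; - $\alpha_\beta$ for $\beta\in\mathcal C_{\neg X}$, such that $$\sum_{i=1}^n\sum_{k=1}^{m_0^{i,+}}\alpha^{i,+}(0,k)C^{i,+}(0,k)+\sum_{i=1}^n\sum_{k=1}^{m_1^{i,-}}\alpha^{i,-}(1,k)C^{i,-}(1,k)$$ $$+\sum_{j=0}^{N_0-1}\Big(\sum_{k=1}^{m_j^{0,+}-1}\alpha^{0,+}(j,k)C^{0,+}(j,k)+\alpha_j^{0,+}R_j^{0,+}\Big)+\sum_{j=1}^{N_0}\Big(\sum_{k=1}^{m_j^{0,-}-1}\alpha^{0,-}(j,k)C^{0,-}(j,k)+\alpha_j^{0,-}R_j^{0,-}\Big)$$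 $$+\sum_{j=0}^{N_0}\alpha_j^0L_j^0+\sum_{\beta\in\mathcal C_{\neg X}}\alpha_\beta C_\beta=0 .$$ Then for all $1\le i\le n$, $$\alpha^{i,+}(0,1)=\dots=\alpha^{i,+}(0,m_0^{i,+})=-\alpha^{i,-}(1,1)=\dots=-\alpha^{i,-}(1,m_1^{i,-}),$$ for all $0\le j\le N_0-1$, $$\alpha^{0,+}(j,1)=\dots=\alpha^{0,+}(j,m_j^{0,+}-1)=\alpha_j^{0,+}=-\alpha^{0,-}(j+1,1)=\dots=-\alpha^{0,-}(j+1,m_{j+1}^{0,-}-1)=-\alpha_{j+1}^{0,-},$$ and moreover $$\alpha_0^0=\alpha^{0,+}(0,1),\qquad \alpha_{N_0}^0=\alpha^{0,-}(N_0,1),\qquad \alpha_j^0=\alpha^{0,+}(j,1)+\alpha^{0,-}(j,1)\ \ (1\le j\le N_0-1),\qquad \alpha_\beta=0\ \ (\beta\in\mathcal C_{\neg X}).$$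
   Context: ITMs. Let $I=[0,1)$. An interval translation mapping (ITM) on $r$ intervals is a map $T:I\to I$ given by parameters $0=\beta_0<\beta_1<\dots<\beta_{r-1}<\beta_r=1$ and $\gamma_1,\dots,\gamma_r\in\mathbb R$ with $\gamma_i\in[-\beta_{i-1},1-\beta_i]$, via $T(x)=x+\gamma_i$ for $x\in I_i=[\beta_{i-1},\beta_i)$; $\mathrm{ITM}(r)$ is the set of these. $X=\bigcap_{n\ge0}T^n(I)$. Each $T^n(I)$ is a finite union of half-open intervals. The orbit of a set $S$ is $\bigcup_{n\ge0}T^n(S)$. Signed points. For a geometric point $x$ let $x^+$ (resp. $x^-$) be its right (resp. left) one-sided germ; $T(x^+):=(\lim_{z\downarrow x}T(z))^+$, $T(x^-):=(\lim_{z\uparrow x}T(z))^-$. A half-open interval $[a,b)$ contains $x^+$ iff $a\le x<b$ and contains $x^-$ iff $a<x\le b$; a signed point is in $X$ iff for every $n$ it lies in one of the component half-open intervals of $T^n(I)$. An interval $J=[x,y)$ has boundary points $x^+$ and $y^-$. The critical set is $\mathcal C=\{\beta_1^\pm,\dots,\beta_{r-1}^\pm\}$; its elements are the (signed) discontinuities ($0^+,1^-$ are not included). $\mathrm{ind}(\beta_s^{\pm})=\mathrm{ind}(\beta_s)=s$. $\mathcal C_1$ is the set of $\beta\in\mathcal C$ with $T^k(\beta)\in\mathcal C$ for some $k\ge1$. For a (signed or geometric) point $z$ and $n\ge0$, $k_s(z,n)=\#\{0\le i<n: T^i(z)\in I_s\}$. Coefficient space. $W(r)=\mathbb R^r\oplus\mathbb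 R^{r-1}$ with canonical bases $(\mathbf e_1,\dots,\mathbf e_r)$ and $(\mathbf f_1,\dots,\mathbf f_{r-1})$. Maximal periodic interval: a maximal interval (half-open) consisting of periodic points of $T$ with the same itinerary (the itinerary of $z$ is the sequence of indices $s$ with $T^n(z)\in I_s$). Data of an interval $J=[x,y)\subset X$. Let $R_J$ be the first return map to $J$; ''before returning'' means at times $0\le t<$ return time. Let $a_1<\dots<a_{N-1}$ ($N=N_J$) be the points in the interior of $J$ that land on discontinuities before returning to $J$, and put $a_0^+:=x^+$, $a_N^-:=y^-$. These points cut $J$ into $N$ subintervals, and on the interior of each of them the return time is constant; $a_j^+$ ($0\le j\le N-1$) returns with the subinterval to its right, and $a_j^-$ ($1\le j\le N$) returns with the subinterval to its left. Let $m_j^{+}$ be the number of discontinuities that $a_j^+$ lands on before returning, and $\beta^{+}(j,1),\dots,\beta^+(j,m_j^+)$ these discontinuities in the order visited; similarly $m_j^-$ and $\beta^-(j,k)$ for $a_j^-$. For $1\le j\le N-1$, $\beta^+(j,1)$ and $\beta^-(j,1)$ are the $+$ and $-$ parts of one geometric discontinuity $\beta(j)$; $\beta(0)$ and $\beta(N)$ denote the geometric discontinuities underlying $\beta^+(0,1)$ and $\beta^-(N,1)$. For $J=J_i$ all these objects carry the superscript $i$ and $N_{J_i}=N_i$; for a maximal periodic interval $N_i=1$. Landing vectors: with $l_j\ge0$ the landing time of $a_j$ (of $a_0^+$, $a_N^-$ for $j=0,N$) on $\beta(j)$ for the first time, $L_j=\big(\sum_s k_s(a_j,l_j)\mathbf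 e_s,\,-\mathbf f_{\mathrm{ind}(\beta(j))}\big)$, $0\le j\le N$. Critical connection vectors: with $q^\pm(j,k)$ the landing time of $\beta^\pm(j,k)$ on $\beta^\pm(j,k+1)$ (the time between these consecutive visits), $C^{\pm}(j,k)=\big(\sum_s k_s(\beta^\pm(j,k),q^\pm(j,k))\mathbf e_s,\ \mathbf f_{\mathrm{ind}(\beta^\pm(j,k))}-\mathbf f_{\mathrm{ind}(\beta^\pm(j,k+1))}\big)$, $1\le k<m_j^\pm$. Return vectors: with $r_j^\pm$ the time at which $\beta^\pm(j,m_j^\pm)$ lands in $J$ (at the return of $a_j^\pm$), $R_j^\pm=\big(\sum_s k_s(\beta^\pm(j,m_j^\pm),r_j^\pm)\mathbf e_s,\ \mathbf f_{\mathrm{ind}(\beta^\pm(j,m_j^\pm))}\big)$. In all of these, the sign $+$ is used for $0\le j\le N-1$ and $-$ for $1\le j\le N$. For the maximal periodic intervals $J_i$, $1\le i\le n$, additionally put $C^{i,+}(0,m_0^{i,+}):=R_0^{i,+}+L_0^i$ and $C^{i,-}(1,m_1^{i,-}):=R_1^{i,-}+L_1^i$. General critical connection vectors: for $\beta\in\mathcal C_1$ let $\beta'$ be the first discontinuity that $\beta$ lands on at a positive time and $q(\beta)\ge1$ the landing time; $C_\beta=\big(\sum_s k_s(\beta,q(\beta))\mathbf e_s,\ \mathbf f_{\mathrm{ind}(\beta)}-\mathbf f_{\mathrm{ind}(\beta')}\big)$. *)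

(* Defs.v *)
From HB Require Import structures.
From mathcomp Require Import all_boot all_order all_algebra.
From mathcomp Require Import all_classical all_reals all_analysis.
Import Order.TTheory GRing.Theory Num.Theory.
Import numFieldNormedType.Exports.

Set Implicit Arguments.
Unset Strict Implicit.
Unset Printing Implicit Defensive.

Local Open Scope classical_set_scope.
Local Open Scope ring_scope.

(* Only the values itm_beta 0, ..., itm_beta r are meaningful.  The intervals
   are indexed from 0: s : 'I_r stands for [itm_beta s, itm_beta s.+1), and
   s : 'I_r.-1 stands for the discontinuity itm_beta s.+1. *)
Record ITM (R : realType) (r : nat) := MkITM {
  itm_beta : nat -> R;
  itm_gamma : 'I_r -> R;
  itm_beta0 : itm_beta 0%N = 0;
  itm_betar : itm_beta r = 1;
  itm_beta_lt : forall s : nat, (s < r)%N -> itm_beta s < itm_beta s.+1;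
  itm_gammaP : forall s : 'I_r,
    - itm_beta s <= itm_gamma s <= 1 - itm_beta s.+1 }.

(* The pair (x, true) is the right germ x^+, and (x, false) is the left germ
   x^-. *)
Definition spoint (R : realType) : Type := (R * bool)%type.

(* Bounds (x, y) of a half-open interval [x, y). *)
Definition bounds (R : realType) : Type := (R * R)%type.

Definition W (R : realType) (r : nat) : lmodType R :=
  ('rV[R]_r * 'rV[R]_r.-1)%type.

(* Least element of P; the value for an empty P is irrelevant. *)
Definition least (P : set nat) : nat :=
  xget 0%N [set n | P n /\ forall m, P m -> (n <= m)%N].

Section Intervals.
Variable R : realType.

Definition ico (J : bounds R) : set R := `[J.1, J.2[%classic.

Definition sgn_in (J : bounds R) (z : spoint R) : bool :=
  if z.2 then J.1 <= z.1 < J.2 else J.1 < z.1 <= J.2.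

Definition lbound_pt (J : bounds R) : spoint R := (J.1, true).
Definition rbound_pt (J : bounds R) : spoint R := (J.2, false).

Definition maximal_ico (P : set R -> Prop) (J : bounds R) : Prop :=
  [/\ J.1 < J.2, P (ico J) &
      forall K : bounds R, ico J `<=` ico K -> P (ico K) -> K = J].

Definition component_ico (A : set R) (J : bounds R) : Prop :=
  maximal_ico (fun S => S `<=` A) J.

End Intervals.

Section Dynamics.
Variables (R : realType) (r : nat) (T : ITM R r).

Definition piece (s : 'I_r) : bounds R := (itm_beta T s, itm_beta T s.+1).

(* The identity outside [0, 1). *)
Definition itm_map (x : R) : R :=
  if [pick s : 'I_r | itm_beta T s <= x < itm_beta T s.+1] is Some s
  then x + itm_gamma T s else x.

Definition itm_smap (z : spoint R) : spoint R :=
  if z.2 then (lim (itm_map u @[u --> z.1^'+]), true)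
  else (lim (itm_map u @[u --> z.1^'-]), false).

Definition image_itm (n : nat) : set R := iter n itm_map @` `[0, 1[%classic.

Definition attractor : set R := \bigcap_(n in setT) image_itm n.

Definition sgn_in_attractor (z : spoint R) : Prop :=
  forall n, exists2 J : bounds R, component_ico (image_itm n) J & sgn_in J z.

Definition set_orbit (S : set R) : set R :=
  \bigcup_(n in setT) (iter n itm_map @` S).

Definition is_disc (x : R) : bool :=
  [exists s : 'I_r.-1, x == itm_beta T s.+1].

Definition critical (z : spoint R) : bool := is_disc z.1.

Definition ind (x : R) : option 'I_r.-1 :=
  [pick s : 'I_r.-1 | x == itm_beta T s.+1].

Definition f_ind (x : R) : 'rV[R]_r.-1 :=
  if ind x is Some s then delta_mx 0 s else 0.

Definition itm_periodic (x : R) : Prop :=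
  exists2 p : nat, (0 < p)%N & iter p itm_map x = x.

Definition same_itinerary (S : set R) : Prop :=
  forall u v : R, S u -> S v -> forall (n : nat) (s : 'I_r),
    ico (piece s) (iter n itm_map u) <-> ico (piece s) (iter n itm_map v).

Definition maximal_periodic (J : bounds R) : Prop :=
  maximal_ico (fun S => [/\ S `<=` `[0, 1[%classic,
    S `<=` itm_periodic & same_itinerary S]) J.

Definition visits_geo (s : 'I_r) (x : R) (n : nat) : nat :=
  count (fun i => `[< ico (piece s) (iter i itm_map x) >]) (iota 0 n).

Definition visits_sgn (s : 'I_r) (z : spoint R) (n : nat) : nat :=
  count (fun i => sgn_in (piece s) (iter i itm_smap z)) (iota 0 n).

Definition e_geo (x : R) (n : nat) : 'rV[R]_r :=
  \sum_(s < r) (visits_geo s x n)%:R *: delta_mx 0 s.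

Definition e_sgn (z : spoint R) (n : nat) : 'rV[R]_r :=
  \sum_(s < r) (visits_sgn s z n)%:R *: delta_mx 0 s.

Definition return_geo (J : bounds R) (x : R) : nat :=
  least [set t | (0 < t)%N /\ ico J (iter t itm_map x)].

Definition return_sgn (J : bounds R) (z : spoint R) : nat :=
  least [set t | (0 < t)%N /\ sgn_in J (iter t itm_smap z)].

(* a lists in increasing order the points a_1 < ... < a_{N-1}. *)
Definition cut_points (J : bounds R) (a : seq R) : Prop :=
  sorted <%R a /\
  forall p : R, p \in a <->
    J.1 < p < J.2 /\
    exists2 t : nat, (t < return_geo J p)%N & is_disc (iter t itm_map p).

Definition ncut (a : seq R) : nat := (size a).+1.

(* a_0 = J.1 and a_N = J.2, the latter being the default value of nth. *)
Definition cut_pt (J : bounds R) (a : seq R) (j : nat) : R :=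
  nth J.2 (J.1 :: a) j.

Definition cut_p (J : bounds R) (a : seq R) (j : nat) : spoint R :=
  (cut_pt J a j, true).

Definition cut_m (J : bounds R) (a : seq R) (j : nat) : spoint R :=
  (cut_pt J a j, false).

(* Times at which z lands on discontinuities before returning to J. *)
Definition landings (J : bounds R) (z : spoint R) : seq nat :=
  [seq t <- iota 0 (return_sgn J z) | critical (iter t itm_smap z)].

Definition nland (J : bounds R) (z : spoint R) : nat := size (landings J z).

(* The index k starts from 1. *)
Definition land_time (J : bounds R) (z : spoint R) (k : nat) : nat :=
  nth 0%N (landings J z) k.-1.

Definition land_pt (J : bounds R) (z : spoint R) (k : nat) : spoint R :=
  iter (land_time J z k) itm_smap z.

Definition Lvec_geo (x : R) : W R r :=
  let l := least [set t | is_disc (iter t itm_map x)] in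
  (e_geo x l, - f_ind (iter l itm_map x)).

Definition Lvec_sgn (z : spoint R) : W R r :=
  let l := least [set t | critical (iter t itm_smap z)] in
  (e_sgn z l, - f_ind (iter l itm_smap z).1).

Definition Lvec (J : bounds R) (a : seq R) (j : nat) : W R r :=
  if j == 0%N then Lvec_sgn (cut_p J a j)
  else if (j < ncut a)%N then Lvec_geo (cut_pt J a j)
  else Lvec_sgn (cut_m J a j).

Definition Cvec (J : bounds R) (z : spoint R) (k : nat) : W R r :=
  (e_sgn (land_pt J z k) (land_time J z k.+1 - land_time J z k),
   f_ind (land_pt J z k).1 - f_ind (land_pt J z k.+1).1).

Definition Rvec (J : bounds R) (z : spoint R) : W R r :=
  let m := nland J z in
  (e_sgn (land_pt J z m) (return_sgn J z - land_time J z m),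
   f_ind (land_pt J z m).1).

(* For a boundary point z of a maximal periodic interval J. *)
Definition Cvec_per (J : bounds R) (z : spoint R) (k : nat) : W R r :=
  if k == nland J z then Rvec J z + Lvec_sgn z else Cvec J z k.

(* The set of (signed) discontinuities is parametrized by 'I_r.-1 * bool. *)
Definition crit_pt (c : 'I_r.-1 * bool) : spoint R := (itm_beta T c.1.+1, c.2).

Definition crit1 (c : 'I_r.-1 * bool) : Prop :=
  exists2 k : nat, (0 < k)%N & critical (iter k itm_smap (crit_pt c)).

Definition crit_notX (c : 'I_r.-1 * bool) : Prop :=
  crit1 c /\ ~ sgn_in_attractor (crit_pt c).

Definition Cvec_crit (c : 'I_r.-1 * bool) : W R r :=
  let q := least [set t | (0 < t)%N /\ critical (iter t itm_smap (crit_pt c))] in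
  (e_sgn (crit_pt c) q,
   f_ind (crit_pt c).1 - f_ind (iter q itm_smap (crit_pt c)).1).

End Dynamics.

(* Main.v *)
Require Import Defs.
From HB Require Import structures.
From mathcomp Require Import all_boot all_order all_algebra.
From mathcomp Require Import all_classical all_reals all_analysis.
From mathcomp Require Import ring lra zify.
Import Order.TTheory GRing.Theory Num.Theory.
Import numFieldNormedType.Exports.
Local Open Scope classical_set_scope.
Local Open Scope ring_scope.
Set Implicit Arguments.
Unset Strict Implicit.
Unset Printing Implicit Defensive.

(** Place the coefficients of the relation as weights on signed points: a
    vector with coefficient c that counts the visits of an orbit segment puts
    the weight c on each signed point of that segment.  Let F(x) be the total
    weight of the signed points to the left of x.  This is a step function on
    [0, 1), with a value F z at every germ z.

    The coordinates along the vectors e_s say that the weights in each interval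
    of continuity I_s sum to zero, so F vanishes in the gap between the two
    germs at each discontinuity.  There are two consequences.  First, the
    weight of a signed discontinuity z is F z for a right germ and - F z for a
    left germ ([weight_left_end], [weight_right_end]).  Secondly, T transports
    F without creating jumps at the images of the discontinuities: the weights
    moved by T are the jumps of the function whose value at x is the sum of the
    values of F over the preimages of x ([cum_transport]).  The coordinates
    along the vectors f_s make the moved weights and the weights telescope
    along the segments up to the points where orbits leave and enter J_0; the
    orbits of the boundary points of periodic intervals close up.  Hence F is
    equal to its transport outside J_0 ([atoms_inv]).

    If F is nonzero at x, then x is in J_0 or has a preimage at which F is
    nonzero; by induction x lies in every T^n(I).  So F is supported by X
    ([cum_support]).  On the germs of X the map T is injective, for otherwise
    the Lebesgue measure of T^n(I) would drop by a fixed amount at each step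
    ([no_overlap], [smap_inj_germ]).  Therefore F has the same value at z and
    T z, if z is a germ of X and T z is not in J_0 ([cumg_invariant]).

    It remains to read off the coefficients.  Injectivity and the disjointness
    of the orbits show that a signed discontinuity of X lies on at most one of
    the orbit segments, so its weight is the coefficient of the vector that
    starts there, and a discontinuity outside X has weight 0 ([w_eq0]).  By
    invariance, the coefficients along the orbit of a boundary germ z, from its
    first landing to its return, are F z, or - F z for a left germ
    ([coef_critical]).  The
    weighted points inside an interval J_i are the cut points only, so F is
    constant between two of them ([F_const]); this links the coefficients of
    the two ends of each piece.  Finally, the coefficient of the landing vector
    of a cut point is the jump of F there ([F_jump]), where F vanishes on the
    outer germs at the ends of J_0 because J_0 is a component of X. *)

(** * Least elements *)

Lemma least_min (P : set nat) (t : nat) : P t ->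
  P (least P) /\ forall m, P m -> (least P <= m)%N.
Proof.
move=> Pt; rewrite /least; case: xgetP => [y _ [Py ymin]//|no].
have exP : exists n, `[< P n >] by exists t; apply/asboolP.
case: (ex_minnP exP) => m /asboolP Pm mmin.
by case: (no m); split=> // k Pk; apply: mmin; apply/asboolP.
Qed.

Lemma leastE (P : set nat) (t : nat) : P t ->
  (forall m, P m -> (t <= m)%N) -> least P = t.
Proof.
move=> Pt tmin; have [Pl lmin] := least_min Pt.
by apply/eqP; rewrite eqn_leq lmin// tmin.
Qed.

Lemma least_neq0 (P : set nat) : least P <> 0%N ->
  P (least P) /\ forall m, P m -> (least P <= m)%N.
Proof. by rewrite /least; case: xgetP => [y _ []|]. Qed.

(** * Germs of signed points *)

Section Germs.
Variable R : realType.
Implicit Types (z : spoint R) (P Q : R -> Prop) (J : bounds R).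

Definition inward z (d : R) : R := if z.2 then z.1 + d else z.1 - d.

(** The filter of one-sided neighbourhoods of z.1, with an explicit radius so that
    the same computations serve left and right germs. *)
Definition germ z P : Prop :=
  exists2 e : R, 0 < e & forall d, 0 < d < e -> P (inward z d).

Lemma germ_and z P Q : germ z P -> germ z Q -> germ z (fun u => P u /\ Q u).
Proof.
move=> [e e0 Pe] [f f0 Qf]; exists (Num.min e f).
  by rewrite lt_min e0 f0.
move=> d /andP[d0]; rewrite lt_min => /andP[de df].
by split; [apply: Pe; rewrite d0|apply: Qf; rewrite d0].
Qed.

Lemma germ_impl z P Q : (forall u, P u -> Q u) -> germ z P -> germ z Q.
Proof. by move=> PQ [e e0 Pe]; exists e => // d /Pe /PQ. Qed.

Lemma germ_all z P : (forall u, P u) -> germ z P.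
Proof. by move=> Pu; exists 1. Qed.

Lemma germ_ex z P : germ z P -> exists u, P u.
Proof.
move=> [e e0 Pe]; exists (inward z (e / 2)); apply: Pe.
by apply/andP; split; lra.
Qed.

Lemma germ_and_ex z P Q : germ z P -> germ z Q -> exists u, P u /\ Q u.
Proof. by move=> gP gQ; apply: germ_ex (germ_and gP gQ). Qed.

(** With [germ_sgn_in]: a half-open interval contains a signed point exactly when
    it contains its germ, whichever the sign; this makes the combinatorial
    membership of signed points a statement about sets of points. *)
Lemma sgn_in_germ J z : sgn_in J z -> germ z (ico J).
Proof.
case: z => x [] /andP /= [h1 h2].
  exists (J.2 - x); first lra.
  by move=> d /= ?; rewrite /ico /inward /= in_itv /=; apply/andP; split; lra.
exists (x - J.1); first lra.
by move=> d /= ?; rewrite /ico /inward /= in_itv /=; apply/andP; split; lra.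
Qed.

Lemma germ_sgn_in J z : germ z (ico J) -> sgn_in J z.
Proof.
case: z => x [] [e e0]; rewrite /ico /inward /sgn_in /= => h.
  have hx d : 0 < d < e -> J.1 <= x + d < J.2.
    by move=> /h; rewrite /= in_itv.
  have /andP[_ h2] : J.1 <= x + e / 2 < J.2 by apply: hx; apply/andP; split; lra.
  apply/andP; split; last lra.
  rewrite leNgt; apply/negP => xJ.
  have /andP[h3 _] : J.1 <= x + Num.min (e / 2) ((J.1 - x) / 2) < J.2.
    apply: hx; rewrite lt_min gt_min; apply/andP; split; last by apply/orP; left; lra.
    by apply/andP; split; lra.
  have : Num.min (e / 2) ((J.1 - x) / 2) <= (J.1 - x) / 2 by rewrite ge_min lexx orbT.
  lra.
have hx d : 0 < d < e -> J.1 <= x - d < J.2.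
  by move=> /h; rewrite /= in_itv.
have /andP[h2 _] : J.1 <= x - e / 2 < J.2 by apply: hx; apply/andP; split; lra.
apply/andP; split; first lra.
rewrite leNgt; apply/negP => xJ.
have /andP[_ h3] : J.1 <= x - Num.min (e / 2) ((x - J.2) / 2) < J.2.
  apply: hx; rewrite lt_min gt_min; apply/andP; split; last by apply/orP; left; lra.
  by apply/andP; split; lra.
have : Num.min (e / 2) ((x - J.2) / 2) <= (x - J.2) / 2 by rewrite ge_min lexx orbT.
lra.
Qed.

Lemma sgn_in_germN J z : ~~ sgn_in J z -> germ z (fun u => ~ ico J u).
Proof.
case: z => x [] /=; rewrite /sgn_in /= negb_and.
  have [xJ _|Jx /= xJ] := ltP x J.1.
    exists (J.1 - x); first lra.
    move=> d ?; rewrite /inward /ico /= in_itv /= => ?; lra.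
  exists 1 => // d ?; rewrite /inward /ico /= in_itv /= => ?; lra.
have [xJ _|Jx /= xJ] := leP x J.1.
  exists 1 => // d ?; rewrite /inward /ico /= in_itv /= => ?; lra.
exists (x - J.2); first lra.
move=> d ?; rewrite /inward /ico /= in_itv /= => ?; lra.
Qed.

(** Statements about right germs thereby reach left germs, by moving to points
    close to z.1. *)
Lemma germ_right z P : germ z P -> germ z (fun u => germ (u, true) P).
Proof.
move=> [e e0 Pe]; exists e => // d /andP[d0 de].
case: z Pe => x [] Pe; rewrite /germ /inward /=.
  exists (e - d); first lra.
  move=> f ?; have := Pe (d + f); rewrite /inward /= addrA; apply; lra.
exists d => // f ?.
have := Pe (d - f); rewrite /inward /= opprB addrA addrAC; apply; lra.
Qed.

End Germs.

(** * Interval translations of points and of germs *)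

Section Basics.
Variables (R : realType) (r : nat) (T : ITM R r).
Implicit Types (z : spoint R) (P Q : R -> Prop).

Definition whole : bounds R := (0, 1).

Lemma itm_beta_le (s t : nat) : (s <= t <= r)%N -> itm_beta T s <= itm_beta T t.
Proof.
move=> /andP[]; elim: t => [|t IH]; first by rewrite leqn0 => /eqP ->.
rewrite leq_eqVlt => /orP[/eqP->//|st] tr.
by apply: (le_trans (IH _ _)) => //; [exact: ltnW|apply/ltW/itm_beta_lt].
Qed.

Lemma itm_beta_lt_mono (s t : nat) : (s < t <= r)%N -> itm_beta T s < itm_beta T t.
Proof.
move=> /andP[st tr]; apply: (@lt_le_trans _ _ (itm_beta T s.+1)).
  by apply: itm_beta_lt; apply: leq_trans tr.
by apply: itm_beta_le; rewrite st.
Qed.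

Lemma beta_ge0 (s : nat) : (s <= r)%N -> 0 <= itm_beta T s.
Proof. by move=> sr; rewrite -(itm_beta0 T); apply: itm_beta_le. Qed.

Lemma beta_le1 (s : nat) : (s <= r)%N -> itm_beta T s <= 1.
Proof. by move=> sr; rewrite -(itm_betar T); apply: itm_beta_le; rewrite sr leqnn. Qed.

Lemma piece_sub (s : 'I_r) z : sgn_in (piece T s) z -> sgn_in whole z.
Proof.
have h0 := beta_ge0 (ltnW (ltn_ord s)); have h1 := beta_le1 (ltn_ord s).
by rewrite /sgn_in /piece /whole /=; case: z => x [] /= ?; lra.
Qed.

Lemma piece_ex z : sgn_in whole z -> exists s : 'I_r, sgn_in (piece T s) z.
Proof.
case: z => x b wz.
pose up (m : nat) := if b then x < itm_beta T m else x <= itm_beta T m.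
have upr : up r by move: wz; rewrite /up itm_betar /sgn_in /=; case: (b) => /andP[].
have up0 : ~~ up 0%N.
  by move: wz; rewrite /up itm_beta0 /sgn_in /=; case: (b) => /andP[]; rewrite -?leNgt -?ltNge.
have exu : exists m, up m by exists r.
case: (ex_minnP exu) => m um mmin.
case: m um mmin => [|m um mmin]; first by move=> u0; rewrite u0 in up0.
have mr : (m < r)%N by apply: mmin.
exists (Ordinal mr); have : ~~ up m by apply/negP => /mmin; rewrite ltnn.
move: um; rewrite /up /sgn_in /=; case: (b) => /=.
  by rewrite -leNgt => -> ->.
by rewrite -ltNge => -> ->.
Qed.

Lemma piece_uniq (s t : 'I_r) z :
  sgn_in (piece T s) z -> sgn_in (piece T t) z -> s = t.
Proof.
have key (u v : 'I_r) : (u < v)%N -> sgn_in (piece T u) z -> ~~ sgn_in (piece T v) z.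
  move=> uv; have := @itm_beta_le u.+1 v; rewrite uv (ltnW (ltn_ord v)) => /(_ isT).
  by rewrite /sgn_in /piece /=; case: z => x [] /= h1 h2; apply/negP => h3; lra.
move=> hs ht; apply/val_inj; case: (ltngtP s t) => // [st|ts].
  by have := key _ _ st hs; rewrite ht.
by have := key _ _ ts ht; rewrite hs.
Qed.

Lemma ico_sgn J (x : R) : ico J x <-> sgn_in J (x, true).
Proof. by rewrite /ico /= in_itv. Qed.

Lemma itm_mapE (s : 'I_r) x : sgn_in (piece T s) (x, true) ->
  itm_map T x = x + itm_gamma T s.
Proof.
move=> hs; rewrite /itm_map; case: pickP => [t ht|/(_ s)].
  by rewrite (@piece_uniq s t (x, true)).
by move: hs; rewrite /sgn_in /= => ->.
Qed.

Lemma germ_map (s : 'I_r) z : sgn_in (piece T s) z ->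
  germ z (fun u => itm_map T u = u + itm_gamma T s).
Proof.
by move=> /sgn_in_germ; apply: germ_impl => u /ico_sgn; apply: itm_mapE.
Qed.

Lemma smapE (s : 'I_r) z : sgn_in (piece T s) z ->
  itm_smap T z = (z.1 + itm_gamma T s, z.2).
Proof.
move=> hs; have [e e0 he] := germ_map hs.
rewrite /itm_smap; case: z hs he => x [] hs he /=; congr pair.
  apply/cvg_lim => //.
  apply: (@cvg_trans _ ((u + itm_gamma T s) @[u --> x^'+])).
    apply: near_eq_cvg; near=> u.
    have := he (u - x); rewrite /inward /= [x + _]addrC subrK => -> //.
    by rewrite subr_gt0; apply/andP; split; near: u;
      [exact: nbhs_right_gt|exact: nbhs_right_ltDr].
  apply: cvgD; last exact: cvg_cst.
  by apply: cvg_at_right_filter; exact: cvg_id.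
apply/cvg_lim => //.
apply: (@cvg_trans _ ((u + itm_gamma T s) @[u --> x^'-])).
  apply: near_eq_cvg; near=> u.
  have := he (x - u); rewrite /inward /= subKr => -> //.
  by rewrite subr_gt0; apply/andP; split; near: u;
    [exact: nbhs_left_lt|exact: nbhs_left_ltBl].
apply: cvgD; last exact: cvg_cst.
by apply: cvg_at_left_filter; exact: cvg_id.
Unshelve. all: by end_near.
Qed.

Lemma smap_whole z : sgn_in whole z -> sgn_in whole (itm_smap T z).
Proof.
move=> /piece_ex[s hs]; rewrite (smapE hs).
have := itm_gammaP T s; move: hs; rewrite /sgn_in /=.
by case: z => x [] /= ? ?; lra.
Qed.

(** The right-hand limit of T at x is its value, since the intervals of
    continuity are closed on the left.  So orbits of points are orbits of
    right germs. *)
Lemma smap_right x : sgn_in whole (x, true) ->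
  itm_smap T (x, true) = (itm_map T x, true).
Proof. by move=> /piece_ex[s hs]; rewrite (smapE hs) (itm_mapE hs). Qed.

Lemma smap_side z : (itm_smap T z).2 = z.2.
Proof. by rewrite /itm_smap; case: z => x []. Qed.

Lemma iter_smap_side z t : (iter t (itm_smap T) z).2 = z.2.
Proof. by elim: t => //= t <-; rewrite smap_side. Qed.

Lemma iter_smap_whole z t : sgn_in whole z ->
  sgn_in whole (iter t (itm_smap T) z).
Proof. by move=> wz; elim: t => //= t; apply: smap_whole. Qed.

Lemma itm_map_whole x : ico whole x -> ico whole (itm_map T x).
Proof.
by move=> /ico_sgn wx; apply/ico_sgn; rewrite -smap_right//; apply: smap_whole.
Qed.

Lemma iter_map_whole x t : ico whole x -> ico whole (iter t (itm_map T) x).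
Proof. by move=> wx; elim: t => //= t; apply: itm_map_whole. Qed.

Lemma iter_smap_right x t : sgn_in whole (x, true) ->
  iter t (itm_smap T) (x, true) = (iter t (itm_map T) x, true).
Proof.
move=> wx; elim: t => //= t ->; apply: smap_right.
by apply/ico_sgn/iter_map_whole/ico_sgn.
Qed.

(** No discontinuity is met on the germ z up to any given time, so an iterate of
    T is a translation there. *)
Lemma germ_iter z t : sgn_in whole z ->
  germ z (fun u => iter t (itm_map T) u
                   = u + ((iter t (itm_smap T) z).1 - z.1)).
Proof.
move=> wz; elim: t => [|t IH]; first by apply: germ_all => u; rewrite /= subrr addr0.
have [s hs] := piece_ex (iter_smap_whole t wz).
have [e e0 he] := germ_map hs; have [f f0 hf] := IH.
exists (Num.min e f); first by rewrite lt_min e0 f0.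
move=> d /andP[d0]; rewrite lt_min => /andP[de df] /=.
rewrite hf ?d0// (smapE hs) /=.
have -> : inward z d + ((iter t (itm_smap T) z).1 - z.1)
          = inward (iter t (itm_smap T) z) d.
  by rewrite /inward iter_smap_side; case: (z.2); ring.
rewrite he ?d0// /inward iter_smap_side; case: (z.2); ring.
Qed.

Lemma germ_pull z t P : sgn_in whole z ->
  germ (iter t (itm_smap T) z) P -> germ z (fun u => P (iter t (itm_map T) u)).
Proof.
move=> wz [e e0 he]; have [f f0 hf] := germ_iter t wz.
exists (Num.min e f); first by rewrite lt_min e0 f0.
move=> d /andP[d0]; rewrite lt_min => /andP[de df] /=.
rewrite hf ?d0//; have := he d; rewrite d0 de => /(_ isT).
suff -> : inward (iter t (itm_smap T) z) d =
  inward z d + ((iter t (itm_smap T) z).1 - z.1) by [].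
by rewrite /inward iter_smap_side; case: (z.2); ring.
Qed.

Lemma germ_push z t P : sgn_in whole z ->
  germ z (fun u => P (iter t (itm_map T) u)) -> germ (iter t (itm_smap T) z) P.
Proof.
move=> wz [e e0 he]; have [f f0 hf] := germ_iter t wz.
exists (Num.min e f); first by rewrite lt_min e0 f0.
move=> d /andP[d0]; rewrite lt_min => /andP[de df] /=.
have := he d; rewrite d0 de => /(_ isT); rewrite hf ?d0//.
suff -> : inward (iter t (itm_smap T) z) d =
  inward z d + ((iter t (itm_smap T) z).1 - z.1) by [].
by rewrite /inward iter_smap_side; case: (z.2); ring.
Qed.

End Basics.

(** * The attractor and its components *)

Section Attractor.
Variables (R : realType) (r : nat) (T : ITM R r).
Implicit Types (z : spoint R) (P Q : R -> Prop).
Local Notation X := (attractor T).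

Lemma image_itm0 : image_itm T 0 = ico (whole R).
Proof. by rewrite /image_itm /= image_id. Qed.

Lemma image_itmS n : image_itm T n.+1 = itm_map T @` image_itm T n.
Proof. by rewrite /image_itm -image_comp. Qed.

Lemma image_itm_whole n : image_itm T n `<=` ico (whole R).
Proof. by move=> _ [x wx <-]; apply: iter_map_whole. Qed.

Lemma attractor_whole x : X x -> ico (whole R) x.
Proof. by move=> /(_ 0%N I); rewrite image_itm0. Qed.

Lemma attractor_map x : X x -> X (itm_map T x).
Proof.
move=> Xx [|n] _; first by rewrite image_itm0; apply/itm_map_whole/attractor_whole.
by rewrite image_itmS; exists x => //; apply: Xx.
Qed.

Lemma attractor_iter x t : X x -> X (iter t (itm_map T) x).
Proof. by move=> Xx; elim: t => //= t; apply: attractor_map. Qed.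

Lemma germ_attractor_whole z : germ z X -> sgn_in (whole R) z.
Proof. by move=> gX; apply/germ_sgn_in/(germ_impl _ gX)/attractor_whole. Qed.

Lemma germ_attractor_iter z t : germ z X -> germ (iter t (itm_smap T) z) X.
Proof.
move=> gX; apply: germ_push; first exact: germ_attractor_whole.
by apply: (germ_impl _ gX) => u; apply: attractor_iter.
Qed.

Lemma germ_fin (I : finType) z (P : I -> R -> Prop) :
  (forall i, germ z (P i)) -> germ z (fun u => forall i, P i u).
Proof.
move=> gP; suff : germ z (fun u => forall i, i \in enum I -> P i u).
  by apply: germ_impl => u hu i; apply: hu; rewrite mem_enum.
elim: (enum I) => [|i s IH]; first by apply: germ_all.
apply: (germ_impl _ (germ_and (gP i) IH)) => u [Pi Ps] j.
by rewrite inE => /orP[/eqP->//|]; apply: Ps.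
Qed.

(** Clopen sets of the topology generated by the intervals [a, b).  The class
    contains the finite unions of such intervals and is easily seen to be stable
    under T, which spares an explicit description of T^n(I). *)
Definition right_clopen (A : set R) : Prop := forall x,
  (A x -> germ (x, true) A) /\ (~ A x -> germ (x, true) (fun u => ~ A u)).

Lemma right_clopen_germ A x : right_clopen A -> germ (x, true) A -> A x.
Proof.
move=> cA gA; apply: contrapT => /(proj2 (cA x)) gN.
by have [u [? ?]] := germ_and_ex gA gN.
Qed.

(** Off the image, none of the finitely many possible preimages of y lies in A
    and in its own interval of continuity, and each of these r conditions
    persists to the right of y. *)
Lemma right_clopen_image A : A `<=` ico (whole R) ->
  right_clopen A -> right_clopen (itm_map T @` A).
Proof.
move=> Aw cA y; split.
  move=> [x Ax <-]; have wx : sgn_in (whole R) (x, true) by apply/ico_sgn; apply: Aw.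
  rewrite -(smap_right T wx); apply: (@germ_push _ _ T (x, true) 1 (itm_map T @` A) wx).
  by apply: (germ_impl _ (proj1 (cA x) Ax)) => u Au; exists u.
move=> nTA.
have : germ (y, true) (fun u => forall s : 'I_r,
    ~ (A (u - itm_gamma T s) /\ ico (piece T s) (u - itm_gamma T s))).
  apply: germ_fin => s.
  suff [e e0 he] : germ (y - itm_gamma T s, true)
      (fun u => ~ (A u /\ ico (piece T s) u)).
    by exists e => // d /he; rewrite /inward /= addrAC.
  have [Ay|nAy] := pselect (A (y - itm_gamma T s)).
    have nI : ~~ sgn_in (piece T s) (y - itm_gamma T s, true).
      apply/negP => hs; apply: nTA; exists (y - itm_gamma T s) => //.
      by rewrite (itm_mapE hs) subrK.
    by apply: (germ_impl _ (sgn_in_germN nI)) => u hu [].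
  by apply: (germ_impl _ (proj2 (cA _) nAy)) => u hu [].
apply: germ_impl => u hu [x Ax Txu].
have [s hs] : exists s, sgn_in (piece T s) (x, true).
  by apply: piece_ex; apply/ico_sgn; apply: Aw.
apply: (hu s); by rewrite -Txu (itm_mapE hs) addrK; split=> //; apply/ico_sgn.
Qed.

Lemma right_clopen_ico (J : bounds R) : right_clopen (ico J).
Proof.
move=> x; split => [/ico_sgn|nJ]; first exact: sgn_in_germ.
by apply: sgn_in_germN; apply/negP => /ico_sgn.
Qed.

Lemma right_clopen_image_itm n : right_clopen (image_itm T n).
Proof.
elim: n => [|n IH]; first by rewrite image_itm0; apply: right_clopen_ico.
by rewrite image_itmS; apply: right_clopen_image => //; apply: image_itm_whole.
Qed.

Lemma attractor_right x : germ (x, true) X -> X x.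
Proof.
move=> gX n _; apply: right_clopen_germ; first exact: right_clopen_image_itm.
by apply: (germ_impl _ gX) => u; apply.
Qed.

(** The component extends from the infimum of the left ends to the supremum of
    the right ends of the intervals that contain I0.  Only the infimum itself is
    in question; it belongs to A because A is closed from the right. *)
Lemma component_ex (A : set R) (I0 : bounds R) : right_clopen A ->
  A `<=` ico (whole R) -> I0.1 < I0.2 -> ico I0 `<=` A ->
  exists J, [/\ component_ico A J, J.1 <= I0.1 & I0.2 <= J.2].
Proof.
case: I0 => u0 v0 /= cA Aw uv0 I0A.
have icoP (a b t : R) : ico (a, b) t <-> a <= t < b by rewrite /ico /= in_itv.
have Ab t : A t -> 0 <= t < 1 by move=> /Aw /icoP.
pose V := [set v | v0 <= v /\ ico (u0, v) `<=` A].
pose U := [set - u | u in [set u | u <= u0 /\ ico (u, u0) `<=` A]].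
have Vv0 : V v0 by split.
have Uu0 : U (- u0).
  by exists u0 => //; split=> // t /icoP; lra.
have Vb v : V v -> v <= 1.
  move=> [vv hv]; rewrite leNgt; apply/negP => v1.
  have /Ab/andP[_] : A (Num.max u0 1).
    by apply: hv; apply/icoP; rewrite le_max lexx /= gt_max v1 andbT; lra.
  by rewrite gt_max ltxx andbF.
have Ub u : u <= u0 -> ico (u, u0) `<=` A -> 0 <= u.
  move=> uu hu; have [->|ne] := eqVneq u u0.
    by have /Ab/andP[] : A u0 by apply: I0A; apply/icoP; rewrite lexx.
  have /Ab/andP[] // : A u by apply: hu; apply/icoP; rewrite lexx lt_neqAle ne.
have supV : has_sup V by split; [exists v0|exists 1 => v; apply: Vb].
have supU : has_sup U.
  split; [by exists (- u0)|exists 0 => _ [u [h1 h2] <-]].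
  by rewrite oppr_le0; apply: Ub.
have hV : v0 <= sup V by apply: sup_upper_bound.
have hU : - u0 <= sup U by apply: sup_upper_bound.
have JA : ico (- sup U, sup V) `<=` A.
  have mid t : - sup U < t -> t < sup V -> A t.
    move=> t1 t2; have [tu|ut] := ltP t u0.
      have [_ [u [_ hu] <-] h] := @sup_adherent _ U (t + sup U) ltac:(lra) supU.
      by apply: hu; apply/icoP; lra.
    have [v [_ hv] h] := @sup_adherent _ V (sup V - t) ltac:(lra) supV.
    by apply: hv; apply/icoP; lra.
  move=> t /icoP/andP[]; rewrite le_eqVlt => /orP[/eqP <-|]; last exact: mid.
  move=> ltV; apply: right_clopen_germ => //.
  exists (sup V + sup U); first lra.
  by move=> d ?; apply: mid; rewrite /inward /=; lra.
exists (- sup U, sup V); split=> /=; [|lra|exact: hV].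
split=> //=; first lra.
move=> [k1 k2] JK KA.
have /icoP Kl : ico (k1, k2) (- sup U) by apply: JK; apply/icoP; lra.
have k2ge : sup V <= k2.
  rewrite leNgt; apply/negP => h.
  have /icoP : ico (k1, k2) k2 by apply: JK; apply/icoP; lra.
  lra.
have k1E : k1 = - sup U.
  suff : - k1 <= sup U by lra.
  apply: sup_upper_bound => //; exists k1 => //; split; first lra.
  by move=> t /icoP ?; apply: KA; apply/icoP; lra.
congr pair => //; apply/eqP; rewrite eq_le k2ge andbT.
apply: sup_upper_bound => //; split; first lra.
by move=> t /icoP ?; apply: KA; apply/icoP; lra.
Qed.

Lemma germ_sgn_in_attractor z : germ z X -> sgn_in_attractor T z.
Proof.
move=> gX n.
have gA : germ z (image_itm T n) by apply: (germ_impl _ gX) => u; apply.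
have cA := right_clopen_image_itm n.
have [I0 [h12 h0 hz]] : exists I0 : bounds R,
    [/\ I0.1 < I0.2, ico I0 `<=` image_itm T n & sgn_in I0 z].
  case: z gA {gX} => x [] gA.
    have Ax := right_clopen_germ cA gA.
    move: gA => [e e0 he]; exists (x, x + e); split; rewrite /sgn_in /=; try lra.
    move=> u; rewrite /ico /= in_itv /= => /andP[].
    rewrite le_eqVlt => /orP[/eqP<-//|xu] ue.
    have := he (u - x); rewrite /inward /= (addrC x) subrK; apply; lra.
  move: gA => [e e0 he]; exists (x - e / 2, x); split; rewrite /sgn_in /=; try lra.
  move=> u; rewrite /ico /= in_itv /= => ?.
  have := he (x - u); rewrite /inward /= subKr; apply; lra.
have [J [cJ J1 J2]] := component_ex cA (@image_itm_whole n) h12 h0.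
exists J => //; move: hz; rewrite /sgn_in; case: (z.2); lra.
Qed.

Lemma component_left J : component_ico X J -> ~ germ (J.1, false) X.
Proof.
move=> [J12 JX Jmax] [e e0 he].
have : (J.1 - e / 2, J.2) = J.
  apply: Jmax => u; rewrite /ico /= !in_itv /= => /andP[u1 u2]; first lra.
  have [uJ|Ju] := ltP u J.1; last by apply: JX; rewrite /ico /= in_itv /= Ju.
  by have := he (J.1 - u); rewrite /inward /= subKr; apply; lra.
by case: J {J12 JX Jmax he} => j1 j2 /= -[]; lra.
Qed.

Lemma component_right J : component_ico X J -> ~ germ (J.2, true) X.
Proof.
move=> [J12 JX Jmax] /[dup] /attractor_right XJ2 [e e0 he].
have : (J.1, J.2 + e / 2) = J.
  apply: Jmax => u; rewrite /ico /= !in_itv /= => /andP[u1 u2]; first lra.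
  have [uJ|] := ltP u J.2; first by apply: JX; rewrite /ico /= in_itv /= u1.
  rewrite le_eqVlt => /orP[/eqP <- //|Ju].
  by have := he (u - J.2); rewrite /inward /= (addrC J.2) subrK; apply; lra.
by case: J {J12 JX Jmax he XJ2} => j1 j2 /= -[]; lra.
Qed.

End Attractor.

(** * Injectivity on the germs of the attractor *)

Section Injectivity.
Variables (R : realType) (r : nat) (T : ITM R r).
Implicit Types (z : spoint R) (P Q : R -> Prop).
Local Notation X := (attractor T).
Local Notation mu := (@lebesgue_measure R).
Local Notation mR := (measurableTypeR R).

Lemma measurable_shift (c : R) (A : set mR) : measurable A ->
  measurable ((fun y : R => y - c) @^-1` A : set mR).
Proof.
move=> mA; rewrite -[X in measurable X]setTI.
by have := @measurable_realfun.measurable_funD _ _ R setT id (cst (- c)) (@measurable_id _ _ _)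
  (@measurable_cst _ _ _ _ _ _) measurableT A mA.
Qed.

Lemma lebesgue_measure_shift (c : R) (A : set mR) : measurable A ->
  mu ((fun y : R => y - c) @^-1` A) = mu A.
Proof.
move=> mA.
have mf : measurable_fun setT ((fun y : R => y - c) : mR -> mR).
  by move=> _ B mB; rewrite setTI; apply: measurable_shift.
pose f : {mfun mR >-> mR} := HB.pack (fun y : R => y - c)
  (isMeasurableFun.Build _ _ _ _ _ mf).
apply/esym; change (mu A = pushforward mu f A).
apply: lebesgue_measure_unique => //= _ [[a b]] _ <-.
rewrite /pushforward.
have -> : f @^-1` `]a, b]%classic = `]a + c, b + c]%classic.
  by apply/seteqP; split => x /=; rewrite !in_itv /=; lra.
rewrite !lebesgue_measure_itv /= !lte_fin ltrD2r.
by case: ifP => // _; rewrite -!EFinB; congr EFin; ring.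
Qed.

(** T is a translation on each of the r pieces of A, so only overlaps between
    the images of the pieces change the measure. *)
Lemma image_measure_le (A : set mR) : measurable A -> A `<=` ico (whole R) ->
  measurable (itm_map T @` A : set mR) /\ (mu (itm_map T @` A) <= mu A)%E.
Proof.
move=> mA Aw.
have micoP (J : bounds R) : measurable (ico J : set mR) by exact: measurable_itv.
suff key (m : nat) : (m <= r)%N ->
    let B := A `&` ico (0, itm_beta T m) in
    measurable (itm_map T @` B : set mR) /\ (mu (itm_map T @` B) <= mu B)%E.
  have -> : A = A `&` ico (0, itm_beta T r) by rewrite itm_betar; exact/esym/setIidl.
  exact: key.
elim: m => [_|m IH mr] B.
  have -> : B = set0.
    by apply/seteqP; split=> // x [_]; rewrite /ico /= itm_beta0 in_itv /=; lra.
  by rewrite image_set0; split; [exact: measurable0|exact: lexx].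
have [m1 m2] := IH (ltnW mr).
pose s := Ordinal mr; pose C := A `&` ico (piece T s).
have BE : B = (A `&` ico (0, itm_beta T m)) `|` C.
  have bm0 := beta_ge0 T (ltnW mr); have bm := itm_beta_lt T mr.
  apply/seteqP; split=> x; rewrite /B /C /ico /= !in_itv /=.
    by case=> Ax ?; have [?|?] := ltP x (itm_beta T m); [left|right]; split=> //; lra.
  by case=> -[Ax ?]; split=> //; lra.
have TC : itm_map T @` C = (fun y => y - itm_gamma T s) @^-1` C.
  apply/seteqP; split=> [_ [x [Ax /ico_sgn hs] <-]|y [Ay /ico_sgn hs]] /=.
    by rewrite (itm_mapE hs) addrK; split=> //; apply/ico_sgn.
  exists (y - itm_gamma T s); first by split=> //; apply/ico_sgn.
  by rewrite (itm_mapE hs) subrK.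
have mC : measurable (C : set mR) by exact: measurableI.
have mTC : measurable (itm_map T @` C : set mR) by rewrite TC; exact: measurable_shift.
have mB' : measurable (A `&` ico (0, itm_beta T m) : set mR) by exact: measurableI.
rewrite BE image_setU; split; first exact: measurableU.
apply: (le_trans (measureU2 _ _ _)) => //.
rewrite measureU //; last first.
  by apply/seteqP; split=> // x [[_ +] [_ +]]; rewrite /ico /= !in_itv /=; lra.
rewrite leeD // TC le_eqVlt; apply/orP; left; apply/eqP.
exact: (lebesgue_measure_shift _ mC).
Qed.

Lemma measurable_image_itm n : measurable (image_itm T n : set mR).
Proof.
elim: n => [|n IH]; first by rewrite image_itm0; exact: measurable_itv.
by rewrite image_itmS; apply: (proj1 (image_measure_le IH _)); exact: image_itm_whole.
Qed.

(** The stretch ]x, x + e[ can be dropped from T^n(I) without changing the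
    image, as ]y, y + e[ has the same image.  So each application of T takes at
    least e away from the measure of T^n(I), which is at most 1 and never
    negative. *)
Lemma no_overlap (x y cx cy e : R) : 0 < e -> x + e <= y ->
  x + cx = y + cy ->
  (forall u, x < u < x + e -> X u /\ itm_map T u = u + cx) ->
  (forall u, y < u < y + e -> X u /\ itm_map T u = u + cy) -> False.
Proof.
move=> e0 xy cxy hx hy.
pose U : set mR := `]x, (x + e)[%classic.
have mU : measurable U by exact: measurable_itv.
have muU : mu U = e%:E.
  rewrite lebesgue_measure_itv /= lte_fin ltrDl e0.
  by rewrite -EFinD; congr EFin; ring.
have step n : (mu (image_itm T n.+1) + e%:E <= mu (image_itm T n))%E.
  have mA := measurable_image_itm n.
  have UA : U `<=` image_itm T n.
    by move=> u; rewrite /U /= in_itv /= => /hx[Xu _]; apply: Xu.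
  have mD : measurable (image_itm T n `\` U : set mR) by exact: measurableD.
  have -> : image_itm T n.+1 = itm_map T @` (image_itm T n `\` U).
    rewrite image_itmS; apply/seteqP; split; last by apply: image_subset => u [].
    move=> _ [u Au <-]; have [Uu|nUu] := pselect (U u); last by exists u.
    move: Uu; rewrite /U /= in_itv /= => ux.
    have [Xv Tv] : X (u + (y - x)) /\ itm_map T (u + (y - x)) = u + (y - x) + cy.
      by apply: hy; lra.
    exists (u + (y - x)); last by rewrite Tv (proj2 (hx _ ux)); lra.
    by split; [exact: Xv|rewrite in_itv /=; lra].
  have -> : mu (image_itm T n) = (mu (image_itm T n `\` U) + e%:E)%E.
    by rewrite (measureDI mu mA mU) (setIidr UA); congr (_ + _)%E.
  rewrite leeD2r //.
  have := image_measure_le mD; case => //.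
  by move=> u [Au _]; exact: image_itm_whole Au.
have bound n : (mu (image_itm T n) + (n%:R * e)%:E <= 1%:E)%E.
  elim: n => [|n IH].
    rewrite image_itm0 mul0r adde0 /ico /= lebesgue_measure_itv /= lte_fin ltr01.
    by rewrite sube0.
  apply: le_trans IH; apply: le_trans (leeD2r _ (step n)).
  rewrite -addeA leeD2l // -EFinD lee_fin -natr1; lra.
have [k ke] : exists k : nat, e^-1 < k%:R.
  by exists (Num.bound (e^-1)); apply: archi_boundP; rewrite invr_ge0 ltW.
have := bound k; apply/negP; rewrite -ltNge.
apply: (@lt_le_trans _ _ (k%:R * e)%:E).
  by rewrite lte_fin -ltr_pdivrMr // div1r.
by rewrite leeDr.
Qed.

(** Two germs with the same side and the same image have neighbourhoods that T
    translates onto each other. *)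
Lemma smap_inj_germ z z' : germ z X -> germ z' X -> z.2 = z'.2 ->
  itm_smap T z = itm_smap T z' -> z = z'.
Proof.
wlog lt_zz : z z' / z.1 < z'.1.
  move=> H gz gz' e12 eT; have [h|h|h] := ltgtP z.1 z'.1; first exact: H.
    by apply/esym/H.
  by case: z z' h e12 {gz gz' eT} => [x b] [x' b'] /= -> ->.
move=> gz gz' e12 eT; exfalso.
have [s hs] := piece_ex T (germ_attractor_whole gz).
have [s' hs'] := piece_ex T (germ_attractor_whole gz').
have [e e0 he] := germ_and gz (germ_map hs).
have [f f0 hf] := germ_and gz' (germ_map hs').
move: eT; rewrite (smapE hs) (smapE hs') => -[eT _].
pose g := Num.min (Num.min e f) (z'.1 - z.1).
have g0 : 0 < g by rewrite !lt_min e0 f0 subr_gt0.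
have ge : g <= e by rewrite /g !ge_min lexx.
have gf : g <= f by rewrite /g !ge_min lexx orbT.
have gz1 : g <= z'.1 - z.1 by rewrite /g !ge_min lexx !orbT.
clearbody g; case: z z' lt_zz e12 he hf eT gz1 {gz gz' hs hs'} => [x b] [x' b'] /= xx <-.
rewrite /inward; case: b => /= he hf eT gz1.
  apply: (@no_overlap x x' (itm_gamma T s) (itm_gamma T s') g) => //; first lra.
    by move=> u ?; have := he (u - x); rewrite (addrC x) subrK; apply; lra.
  by move=> u ?; have := hf (u - x'); rewrite (addrC x') subrK; apply; lra.
apply: (@no_overlap (x - g) (x' - g) (itm_gamma T s) (itm_gamma T s') g) => //; try lra.
  by move=> u ?; have := he (x - u); rewrite subKr; apply; lra.
by move=> u ?; have := hf (x' - u); rewrite subKr; apply; lra.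
Qed.

Lemma iter_smap_inj_germ z z' t : germ z X -> germ z' X -> z.2 = z'.2 ->
  iter t (itm_smap T) z = iter t (itm_smap T) z' -> z = z'.
Proof.
move=> gz gz' e12; elim: t => //= t IH eT; apply: IH.
apply: smap_inj_germ eT; [exact: germ_attractor_iter|exact: germ_attractor_iter|].
by rewrite !iter_smap_side.
Qed.

End Injectivity.

(** * Step functions with prescribed jumps *)

Section Atoms.
Variables (R : realType) (r : nat) (T : ITM R r).
Implicit Types (z : spoint R) (h : spoint R -> R).
Local Notation X := (attractor T).

Variable At : seq (R * spoint R).

(** [cumR] and [cumL] are the values at the right and the left germ of x of the
    step function with jumps At; an atom at x is to the left of the right germ,
    whatever its sign. *)
Definition cumR (x : R) : R := \sum_(a <- At) a.1 * (a.2.1 <= x)%R%:R.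
Definition cumL (x : R) : R := \sum_(a <- At) a.1 * (a.2.1 < x)%R%:R.
Definition cumg z : R := if z.2 then cumR z.1 else cumL z.1.

Lemma cum_germ z : germ z (fun u => cumR u = cumg z).
Proof.
rewrite /cumg /cumR /cumL; elim: At => [|a l IH].
  by apply: germ_all => u; rewrite !big_nil; case: ifP.
have ha : germ z (fun u =>
    (a.2.1 <= u) = if z.2 then a.2.1 <= z.1 else a.2.1 < z.1).
  case: z {IH} => x [] /=.
    have [ax|xa] := leP a.2.1 x.
      by exists 1 => // d ?; rewrite /inward /=; apply/idP; lra.
    exists (a.2.1 - x); first lra.
    by move=> d ?; rewrite /inward /=; apply/negP/negP; lra.
  have [ax|xa] := ltP a.2.1 x.
    exists (x - a.2.1); first lra.
    by move=> d ?; rewrite /inward /=; apply/idP; lra.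
  by exists 1 => // d ?; rewrite /inward /=; apply/negP/negP; lra.
apply: (germ_impl _ (germ_and ha IH)) => u [hau hu].
by rewrite !big_cons hau hu; case: (z.2).
Qed.

Lemma cum_jump (x : R) : cumR x - cumL x = \sum_(a <- At | a.2.1 == x) a.1.
Proof.
rewrite /cumR /cumL -sumrB [RHS]big_mkcond; apply: eq_bigr => a _.
by case: (ltgtP a.2.1 x) => _; rewrite /= ?mulr1 ?mulr0 ?subrr ?subr0.
Qed.

Lemma cum_const (u v : R) : u < v ->
  (forall a, a \in At -> u < a.2.1 < v -> a.1 = 0) ->
  cumg (u, true) = cumg (v, false).
Proof.
move=> uv hA; rewrite /cumg /= /cumR /cumL.
rewrite big_seq_cond [RHS]big_seq_cond; apply: eq_bigr => a /andP[aA _].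
have [au|ua] := leP a.2.1 u; first by rewrite (le_lt_trans au uv).
have [av|//] := ltP a.2.1 v; by rewrite (hA a aA) ?ua// !mul0r.
Qed.

Hypothesis At_whole : forall a, a \in At -> sgn_in (whole R) a.2.
Hypothesis At_bal : forall s : 'I_r, \sum_(a <- At | sgn_in (piece T s) a.2) a.1 = 0.

Lemma sum_pieces h : \sum_(a <- At) a.1 * h a.2 =
  \sum_(s < r) \sum_(a <- At | sgn_in (piece T s) a.2) a.1 * h a.2.
Proof.
transitivity (\sum_(a <- At) \sum_(s < r)
    if sgn_in (piece T s) a.2 then a.1 * h a.2 else 0).
  rewrite big_seq_cond [RHS]big_seq_cond; apply: eq_bigr => a /andP[aA _].
  have [s hs] := piece_ex T (At_whole aA).
  rewrite (bigD1 s) //= hs big1 ?addr0 // => t ts.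
  by case: ifP => // ht; rewrite (piece_uniq hs ht) eqxx in ts.
by rewrite exchange_big; apply: eq_bigr => s _; rewrite [RHS]big_mkcond.
Qed.

Lemma sum_piece_const (s : 'I_r) h (c : R) :
  (forall z, sgn_in (piece T s) z -> h z = c) ->
  \sum_(a <- At | sgn_in (piece T s) a.2) a.1 * h a.2 = 0.
Proof.
move=> hc; rewrite (eq_bigr (fun a => a.1 * c)) => [|a /hc ->//].
by rewrite -mulr_suml At_bal mul0r.
Qed.

Lemma sum_total : \sum_(a <- At) a.1 = 0.
Proof.
transitivity (\sum_(a <- At) a.1 * (fun=> 1) a.2).
  by apply: eq_bigr => a _; rewrite mulr1.
rewrite (sum_pieces (fun=> 1)); apply: big1 => s _.
by apply: (@sum_piece_const s (fun=> 1) 1).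
Qed.

(** The other pieces carry zero total weight, so a function that is constant on
    each of them only sees the piece s. *)
Lemma sum_one_piece (s : 'I_r) h :
  (forall t : 'I_r, t != s -> exists c, forall z, sgn_in (piece T t) z -> h z = c) ->
  \sum_(a <- At) a.1 * h a.2 =
  \sum_(a <- At | sgn_in (piece T s) a.2) a.1 * h a.2.
Proof.
move=> hc; rewrite sum_pieces (bigD1 s) //= [X in _ + X]big1 ?addr0 // => t /hc[c].
exact: sum_piece_const.
Qed.

Lemma piece_sep (s t : 'I_r) : t != s ->
  itm_beta T t.+1 <= itm_beta T s \/ itm_beta T s.+1 <= itm_beta T t.
Proof.
move=> ts; have [st|st|/val_inj st] := ltngtP t s; last by rewrite st eqxx in ts.
  by left; apply: itm_beta_le; rewrite st ltnW.
by right; apply: itm_beta_le; rewrite st ltnW.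
Qed.

Lemma cumR_piece (s : 'I_r) (x : R) : sgn_in (piece T s) (x, true) ->
  cumR x = \sum_(a <- At | sgn_in (piece T s) a.2) a.1 * (a.2.1 <= x)%R%:R.
Proof.
move=> hs; apply: (@sum_one_piece s (fun z => (z.1 <= x)%R%:R)) => t /piece_sep h.
move: hs; rewrite /sgn_in /= => hs; case: h => h; [exists 1|exists 0] => -[y []].
- by move=> /= ?; rewrite (_ : y <= x) //; lra.
- by move=> /= ?; rewrite (_ : y <= x) //; lra.
- by move=> /= ?; rewrite (_ : (y <= x) = false) //; apply/negP; lra.
- by move=> /= ?; rewrite (_ : (y <= x) = false) //; apply/negP; lra.
Qed.

Lemma cumL_piece (s : 'I_r) (x : R) : sgn_in (piece T s) (x, false) ->
  cumL x = \sum_(a <- At | sgn_in (piece T s) a.2) a.1 * (a.2.1 < x)%R%:R.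
Proof.
move=> hs; apply: (@sum_one_piece s (fun z => (z.1 < x)%R%:R)) => t /piece_sep h.
move: hs; rewrite /sgn_in /= => hs; case: h => h; [exists 1|exists 0] => -[y []].
- by move=> /= ?; rewrite (_ : y < x) //; lra.
- by move=> /= ?; rewrite (_ : y < x) //; lra.
- by move=> /= ?; rewrite (_ : (y < x) = false) //; apply/negP; lra.
- by move=> /= ?; rewrite (_ : (y < x) = false) //; apply/negP; lra.
Qed.

(** Start the summation in the gap between the two germs at the discontinuity,
    where the step function vanishes: the first weight met is that of the right
    germ. *)
Lemma weight_left_end (s : 'I_r) : let z := (itm_beta T s, true) in
  \sum_(a <- At | a.2 == z) a.1 = cumg z.
Proof.
have bs := itm_beta_lt T (ltn_ord s).
rewrite /cumg /= (@cumR_piece s); last by rewrite /sgn_in /= lexx.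
rewrite big_mkcond [RHS]big_mkcond; apply: eq_bigr => -[w [y []]] _ /=;
  rewrite xpair_eqE /sgn_in /= ?andbT ?andbF.
  case: (ltgtP y (itm_beta T s)) => h /=; rewrite ?mulr1 ?mulr0 //.
    by case: ifP.
  by rewrite h bs.
by case: ifP => // ?; rewrite (_ : (y <= _) = false) ?mulr0 //; apply/negP; lra.
Qed.

Lemma weight_right_end (s : 'I_r) : let z := (itm_beta T s.+1, false) in
  \sum_(a <- At | a.2 == z) a.1 = - cumg z.
Proof.
have bs := itm_beta_lt T (ltn_ord s).
rewrite /cumg /= (@cumL_piece s); last by rewrite /sgn_in /= lexx bs.
apply/eqP; rewrite -subr_eq0 opprK; apply/eqP; rewrite -[RHS](At_bal s).
rewrite [X in X + _ = _]big_mkcond /= [X in _ + X = _]big_mkcond /= [RHS]big_mkcond -big_split.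
apply: eq_bigr => -[w [y []]] _ /=; rewrite xpair_eqE /sgn_in /= ?andbT ?andbF.
  by rewrite add0r; case: ifP => // /andP[_ ->]; rewrite mulr1.
case: (ltgtP y (itm_beta T s.+1)) => h /=; rewrite ?andbT ?andbF ?addr0 //.
  by rewrite add0r mulr1.
by rewrite h bs mulr0 addr0.
Qed.

(** The hypothesis At_bal says that the step function vanishes in the gap
    between the two germs at every point of discontinuity, so that T pushes
    each of its restrictions to an interval of continuity forward without
    creating jumps. *)
Lemma cum_transport (x : R) :
  \sum_(a <- At) a.1 * ((itm_smap T a.2).1 <= x)%R%:R =
  \sum_(s < r) if sgn_in (piece T s) (x - itm_gamma T s, true)
               then cumR (x - itm_gamma T s) else 0.
Proof.
rewrite (sum_pieces (fun z => ((itm_smap T z).1 <= x)%R%:R)); apply: eq_bigr => s _.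
pose y := x - itm_gamma T s; rewrite -/y.
transitivity (\sum_(a <- At | sgn_in (piece T s) a.2) a.1 * (a.2.1 <= y)%R%:R).
  by apply: eq_bigr => a ha; rewrite (smapE ha) /= lerBrDr.
case: ifP => hs; first by rewrite -cumR_piece.
have [yb|yb] := ltP y (itm_beta T s).
  apply: (@sum_piece_const s (fun z => (z.1 <= y)%R%:R) 0) => -[u []]; rewrite /sgn_in /=.
    by move=> ?; rewrite (_ : (u <= y) = false) //; apply/negP; lra.
  by move=> ?; rewrite (_ : (u <= y) = false) //; apply/negP; lra.
have {}yb : itm_beta T s.+1 <= y.
  by rewrite leNgt; apply/negP => h; move: hs; rewrite /sgn_in /= yb h.
apply: (@sum_piece_const s (fun z => (z.1 <= y)%R%:R) 1) => -[u []]; rewrite /sgn_in /=.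
  by move=> ?; rewrite (_ : (u <= y)) //; lra.
by move=> ?; rewrite (_ : (u <= y)) //; lra.
Qed.

Variable J0 : bounds R.
Hypothesis J0_X : ico J0 `<=` X.
Hypothesis At_inv : forall x, ico (whole R) x -> ~ ico J0 x ->
  \sum_(a <- At) a.1 * ((itm_smap T a.2).1 <= x)%R%:R = cumR x.

(** A nonzero value outside J0 comes from a preimage with a nonzero value, and
    J0 is in the attractor. *)
Lemma cum_support x : ico (whole R) x -> cumR x <> 0 -> X x.
Proof.
move=> wx cx n _; elim: n x wx cx => [|n IH] x wx cx; first by rewrite image_itm0.
have [Jx|nJx] := pselect (ico J0 x); first by apply: (J0_X Jx).
move: cx; rewrite -At_inv // cum_transport => /eqP cx.
have [s hs cs] : exists2 s : 'I_r, sgn_in (piece T s) (x - itm_gamma T s, true)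
                              & cumR (x - itm_gamma T s) <> 0.
  apply: contrapT => hn; move/eqP: cx; apply; apply: big1 => s _.
  by case: ifP => // hs; apply: contrapT => hc; apply: hn; exists s.
rewrite image_itmS; exists (x - itm_gamma T s); last by rewrite (itm_mapE hs) subrK.
by apply: IH => //; apply/ico_sgn/(piece_sub hs).
Qed.

Lemma cumg_eq0 z : ~ germ z X -> cumg z = 0.
Proof.
move=> nX; have [wz|nwz] := boolP (sgn_in (whole R) z).
  apply: contrapT => cz; apply: nX.
  apply: (germ_impl _ (germ_and (cum_germ z) (sgn_in_germ wz))) => u [cu wu].
  by apply: cum_support; rewrite ?cu.
have tot (P : R -> bool) : (forall a, a \in At -> P a.2.1) ->
    \sum_(a <- At) a.1 * (P a.2.1)%:R = 0.
  move=> hP; rewrite -[RHS]sum_total big_seq_cond [RHS]big_seq_cond.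
  by apply: eq_bigr => a /andP[/hP-> _]; rewrite mulr1.
have none (P : R -> bool) : (forall a, a \in At -> ~~ P a.2.1) ->
    \sum_(a <- At) a.1 * (P a.2.1)%:R = 0.
  move=> hP; rewrite big_seq_cond big1 // => a /andP[/hP/negbTE-> _].
  by rewrite mulr0.
case: z {nX} nwz => x [] /=; rewrite /sgn_in /cumg /= negb_and -?ltNge -?leNgt.
  case/orP => hx; [apply: (none (fun u => u <= x))|apply: (tot (fun u => u <= x))].
    by move=> [w [y []]] /At_whole; rewrite /sgn_in /= => ?; apply/negP; lra.
  by move=> [w [y []]] /At_whole; rewrite /sgn_in /= => ?; lra.
case/orP => hx; [apply: (none (fun u => u < x))|apply: (tot (fun u => u < x))].
  by move=> [w [y []]] /At_whole; rewrite /sgn_in /= => ?; apply/negP; lra.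
by move=> [w [y []]] /At_whole; rewrite /sgn_in /= => ?; lra.
Qed.

(** Among the preimages of T x only x can carry a nonzero value: another one
    would be the base point of a germ of the attractor with the same image. *)
Lemma cumR_invariant x : germ (x, true) X -> ~ ico J0 (itm_map T x) ->
  cumR (itm_map T x) = cumR x.
Proof.
move=> gX nJ; have wx := germ_attractor_whole gX.
have [s hs] := piece_ex T wx.
have Tx := itm_mapE hs.
rewrite -At_inv //; last by apply: itm_map_whole; apply/ico_sgn.
rewrite cum_transport (bigD1 s) //= Tx addrK hs big1 ?addr0 // => t ts.
rewrite -Tx; case: ifP => // ht; set y := _ - _ in ht *.
apply: contrapT => cy.
have gy : germ (y, true) X.
  apply: (germ_impl _ (germ_and (cum_germ (y, true)) (sgn_in_germ (piece_sub ht)))).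
  by move=> u [cu wu]; apply: cum_support; rewrite ?cu.
have : (y, true) = (x, true).
  apply: (smap_inj_germ gy gX) => //.
  by rewrite (smapE ht) (smapE hs) /= /y subrK Tx.
move=> yx; rewrite yx in ht.
by rewrite (piece_uniq hs ht) eqxx in ts.
Qed.

Lemma cumg_invariant z : germ z X -> ~~ sgn_in J0 (itm_smap T z) ->
  cumg (itm_smap T z) = cumg z.
Proof.
move=> gX nJ; have wz := germ_attractor_whole gX.
have pull P : germ (itm_smap T z) P -> germ z (fun u => P (itm_map T u)).
  exact: (@germ_pull _ _ T z 1).
have [u [[gu nJu] [cu cTu]]] := germ_and_ex
  (germ_and (germ_right gX) (pull _ (sgn_in_germN nJ)))
  (germ_and (cum_germ z) (pull _ (cum_germ (itm_smap T z)))).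
by rewrite -cu -cTu cumR_invariant.
Qed.

Lemma cumg_iter_invariant z t : germ z X ->
  (forall i, (0 < i <= t)%N -> ~~ sgn_in J0 (iter i (itm_smap T) z)) ->
  cumg (iter t (itm_smap T) z) = cumg z.
Proof.
move=> gX; elim: t => //= t IH hJ; rewrite cumg_invariant ?IH //.
- by move=> i /andP[i0 it]; apply: hJ; rewrite i0 leqW.
- exact: germ_attractor_iter.
by apply: (hJ t.+1); rewrite leqnn.
Qed.

End Atoms.

(** * The step function of a relation between orbits *)

Section OrbitRelation.
Variables (R : realType) (r : nat) (T : ITM R r).
Implicit Types (z : spoint R).
Local Notation X := (attractor T).
Local Notation "z |> t" := (iter t (itm_smap T) z) (at level 10, t at level 9).

Variables (H O : finType) (h0 : H) (J : H -> bounds R).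
Hypothesis J_X : forall h, ico (J h) `<=` X.
Hypothesis J_disj : trivIset setT (fun h => set_orbit T (ico (J h))).

Variables (home : O -> H) (zo : O -> spoint R) (rt : O -> nat) (C : O -> nat -> R).
Hypothesis zo_home : forall o, sgn_in (J (home o)) (zo o).
Hypothesis rt_notin : forall o t, (0 < t < rt o)%N ->
  ~~ sgn_in (J (home o)) (zo o |> t).
Hypothesis rt_in : forall o, sgn_in (J (home o)) (zo o |> (rt o)).
Hypothesis rt_gt0 : forall o, (0 < rt o)%N.
Hypothesis zo_inj : forall o o', home o = home o' -> zo o = zo o' -> o = o'.
Hypothesis periodic_closed : forall o, home o != h0 ->
  zo o |> (rt o) = zo o /\ C o (rt o) = C o 0%N.

Variables (w : 'I_r.-1 * bool -> R) (q : 'I_r.-1 * bool -> nat).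
Local Notation cp := (crit_pt T).
Hypothesis w_notX : forall c, w c <> 0 -> crit_notX T c.
Hypothesis q_gt0 : forall c, crit_notX T c -> (0 < q c)%N.
Hypothesis q_min : forall c i, crit_notX T c -> (0 < i < q c)%N ->
  ~~ critical T (cp c |> i).

Hypothesis e_rel : forall s : 'I_r,
  \sum_o \sum_(0 <= t < rt o) C o t.+1 * (sgn_in (piece T s) (zo o |> t))%:R
  + \sum_c \sum_(0 <= i < q c) w c * (sgn_in (piece T s) (cp c |> i))%:R = 0.
Hypothesis f_rel : forall k : R -> R,
  \sum_o \sum_(0 <= t < rt o) (C o t.+1 - C o t) * k (zo o |> t).1
  + \sum_c w c * (k (cp c).1 - k (cp c |> (q c)).1) = 0.

(** The weight C o t.+1 is placed at time t: C o t is the coefficient in force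
    just before a landing at time t, and C o t.+1 the one just after. *)
Definition atoms : seq (R * spoint R) :=
  [seq (C o t.+1, zo o |> t) | o <- enum O, t <- iota 0 (rt o)] ++
  [seq (w c, cp c |> i) | c <- enum [set: 'I_r.-1 * bool]%SET, i <- iota 0 (q c)].

Lemma sum_atoms (F : R * spoint R -> R) :
  \sum_(a <- atoms) F a =
  \sum_o \sum_(0 <= t < rt o) F (C o t.+1, zo o |> t)
  + \sum_c \sum_(0 <= i < q c) F (w c, cp c |> i).
Proof.
rewrite big_cat !big_allpairs_dep /= !big_enum /=; congr (_ + _).
  by apply: eq_bigr => o _; rewrite /index_iota subn0.
by apply: eq_big => [c|c _]; rewrite ?inE // /index_iota subn0.
Qed.

Lemma zo_germ o : germ (zo o) (ico (J (home o))).
Proof. exact/sgn_in_germ/zo_home. Qed.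

Lemma zo_X o : germ (zo o) X.
Proof. by apply: (germ_impl _ (zo_germ o)) => u; apply: J_X. Qed.

Lemma zo_iter_X o t : germ (zo o |> t) X.
Proof. exact/germ_attractor_iter/zo_X. Qed.

Lemma zo_iter_orbit o t : germ (zo o |> t) (set_orbit T (ico (J (home o)))).
Proof.
apply: germ_push; first exact: (germ_attractor_whole (zo_X o)).
by apply: (germ_impl _ (zo_germ o)) => u Ju; exists t => //; exists u.
Qed.

(** The orbits of distinct intervals are disjoint, and by the choice of the
    return time the orbit is back in its own interval only at time 0. *)
Lemma orbit_home o t h : sgn_in (J h) (zo o |> t) -> (t < rt o)%N ->
  home o = h /\ t = 0%N.
Proof.
move=> /[dup] hJ /sgn_in_germ gJ tr.
have [u [u1 u2]] := germ_and_ex (zo_iter_orbit o t) gJ.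
have ho : home o = h.
  by apply: J_disj => //; exists u; split=> //; exists 0%N => //; exists u.
split=> //; case: t tr hJ {gJ u1} => // t tr; rewrite -ho => hJ.
by have := @rt_notin o t.+1; rewrite tr hJ => /(_ isT).
Qed.

(** By injectivity of T on the germs of the attractor, an orbit that meets
    another one passes through its starting germ, which is a return. *)
Lemma orbit_uniq o t o' t' : (t < rt o)%N -> (t' < rt o')%N ->
  zo o |> t = zo o' |> t' -> o = o' /\ t = t'.
Proof.
wlog tt : o t o' t' / (t <= t')%N.
  move=> Hw tr tr' e; have [h|h] := leqP t t'; first exact: Hw.
  by have [-> ->] := Hw _ _ _ _ (ltnW h) tr' tr (esym e).
move=> tr tr'; rewrite -(subnKC tt) iterD => e.
have e2 : (zo o).2 = (zo o').2.
  by rewrite -(iter_smap_side T (zo o) t) e !iter_smap_side.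
have ez : zo o = zo o' |> (t' - t).
  by apply: iter_smap_inj_germ e; rewrite ?iter_smap_side //;
    [exact: zo_X|exact: zo_iter_X].
have [ho t0] : home o' = home o /\ (t' - t)%N = 0%N.
  apply: orbit_home; first by rewrite -ez.
  by apply: leq_ltn_trans tr'; rewrite leq_subr.
rewrite t0 /= in ez; split; first exact: zo_inj.
by rewrite t0 addn0.
Qed.

Lemma beta_interior (s : 'I_r.-1) : 0 < itm_beta T s.+1 < 1.
Proof.
have sr : (s.+1 < r)%N by have := ltn_ord s; rewrite ltn_predRL.
apply/andP; split; first by rewrite -(itm_beta0 T) itm_beta_lt_mono //= ltnW.
by rewrite -(itm_betar T) itm_beta_lt_mono // sr leqnn.
Qed.

Lemma cp_whole c : sgn_in (whole R) (cp c).
Proof.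
by have := beta_interior c.1; rewrite /crit_pt /sgn_in /=; case: (c.2) => /=; lra.
Qed.

Lemma atoms_whole a : a \in atoms -> sgn_in (whole R) a.2.
Proof.
rewrite mem_cat => /orP[] /allpairsPdep[x [t [_ _ ->]]] /=.
  exact/germ_attractor_whole/zo_iter_X.
exact/iter_smap_whole/cp_whole.
Qed.

Lemma atoms_bal (s : 'I_r) : \sum_(a <- atoms | sgn_in (piece T s) a.2) a.1 = 0.
Proof.
rewrite -[RHS](e_rel s) big_mkcond sum_atoms /=.
by congr (_ + _); apply: eq_bigr => x _; apply: eq_bigr => t _;
  case: ifP; rewrite ?mulr1 ?mulr0.
Qed.

Lemma abel_sum (c k : nat -> R) n :
  \sum_(0 <= t < n) c t.+1 * (k t.+1 - k t) =
  c n * k n - c 0%N * k 0%N - \sum_(0 <= t < n) (c t.+1 - c t) * k t.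
Proof.
elim: n => [|n IH]; first by rewrite !big_nil; ring.
by rewrite !big_nat_recr //= IH; ring.
Qed.

(** Moving the weights by T shifts them along the orbits.  After summation by
    parts the landings cancel by the f-coordinates, the orbits away from J h0
    close up, and the starting and returning points on J h0 are left. *)
Lemma atoms_boundary (x : R) :
  \sum_(a <- atoms) a.1 * ((itm_smap T a.2).1 <= x)%R%:R - cumR atoms x =
  \sum_(o | home o == h0)
    (C o (rt o) * ((zo o |> (rt o)).1 <= x)%R%:R - C o 0%N * ((zo o).1 <= x)%R%:R).
Proof.
pose k (y : R) : R := (y <= x)%R%:R.
rewrite /cumR -sumrB.
transitivity (\sum_(a <- atoms) a.1 * (k (itm_smap T a.2).1 - k a.2.1)).
  by apply: eq_bigr => a _; rewrite mulrBr.
rewrite (sum_atoms (fun a => a.1 * (k (itm_smap T a.2).1 - k a.2.1))) /=.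
under [X in X + _]eq_bigr => o _ do
  rewrite (@abel_sum (C o) (fun t => k (zo o |> t).1)).
rewrite sumrB -addrA [- _ + _]addrC.
have -> : \sum_c \sum_(0 <= i < q c)
    w c * (k (itm_smap T (cp c |> i)).1 - k (cp c |> i).1)
  = - \sum_c w c * (k (cp c).1 - k (cp c |> (q c)).1).
  rewrite -sumrN; apply: eq_bigr => c _.
  rewrite -mulr_sumr (telescope_sumr (fun i => k (cp c |> i).1)) //=; ring.
have /eqP := f_rel k; rewrite addr_eq0 => /eqP ->.
rewrite opprK addNr addr0 [LHS](bigID (fun o => home o == h0)) /=.
rewrite [X in _ + X]big1 ?addr0 // => o /periodic_closed[ez ->].
by rewrite ez subrr.
Qed.

(** The boundary terms sit in the closure of J h0.  To its left they do not
    count; to its right all of them count, and their sum is the difference at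
    x = 1, which is zero as T preserves the total weight. *)
Lemma atoms_inv x : ico (whole R) x -> ~ ico (J h0) x ->
  \sum_(a <- atoms) a.1 * ((itm_smap T a.2).1 <= x)%R%:R = cumR atoms x.
Proof.
move=> wx nJ; apply/eqP; rewrite -subr_eq0 atoms_boundary.
have close z : sgn_in (J h0) z -> (J h0).1 <= z.1 <= (J h0).2.
  by case: z => y []; rewrite /sgn_in /=; lra.
have [xJ|Jx] := ltP x (J h0).1.
  rewrite big1 // => o /eqP ho; have := zo_home o; have := rt_in o; rewrite ho.
  have out z : sgn_in (J h0) z -> (z.1 <= x)%R = false.
    by move=> /close h; apply/negP; lra.
  by move=> /out -> /out ->; rewrite !mulr0 subrr.
have {}Jx : (J h0).2 <= x.
  rewrite leNgt; apply/negP => xJ; apply: nJ; rewrite /ico /= in_itv /=.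
  by rewrite Jx xJ.
have le1 z : sgn_in (whole R) z -> z.1 <= 1.
  by case: z => y []; rewrite /sgn_in /=; lra.
have e0 : \sum_(a <- atoms) a.1 * ((itm_smap T a.2).1 <= 1)%R%:R
          - cumR atoms 1 = 0.
  apply/eqP; rewrite subr_eq0; apply/eqP.
  rewrite /cumR big_seq_cond [RHS]big_seq_cond; apply: eq_bigr => a /andP[+ _].
  by move=> /atoms_whole wa; rewrite !le1 //; apply: smap_whole.
rewrite -[X in _ == X]e0 atoms_boundary; apply/eqP; apply: eq_bigr => o /eqP ho.
have w1 := germ_attractor_whole (zo_X o).
have w2 := iter_smap_whole T (rt o) w1.
rewrite (le1 _ w1) (le1 _ w2).
have inn z : sgn_in (J h0) z -> (z.1 <= x)%R by move=> /close h; lra.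
by have := zo_home o; have := rt_in o; rewrite ho => /inn -> /inn ->.
Qed.

Local Notation F := (cumg atoms).

Lemma weight_critical z : critical T z ->
  \sum_(a <- atoms | a.2 == z) a.1 = if z.2 then F z else - F z.
Proof.
case: z => x b /existsP[s /eqP /= ->].
have sr : (s.+1 < r)%N by have := ltn_ord s; rewrite ltn_predRL.
case: b.
  exact: (@weight_left_end _ _ T atoms atoms_whole atoms_bal (Ordinal sr)).
exact: (@weight_right_end _ _ T atoms atoms_whole atoms_bal (Ordinal (ltnW sr))).
Qed.

Lemma F_notX z : ~ germ z X -> F z = 0.
Proof. exact: (cumg_eq0 atoms_whole atoms_bal (@J_X h0) atoms_inv). Qed.

Lemma F_orbit o t : (t < rt o)%N -> F (zo o |> t) = F (zo o).
Proof.
move=> tr; apply: (cumg_iter_invariant atoms_whole atoms_bal (@J_X h0) atoms_inv).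
  exact: zo_X.
move=> i /andP[i0 it]; apply/negP => hJ.
have [_ ?] := orbit_home hJ (leq_ltn_trans it tr).
by rewrite (_ : i = 0%N) in i0.
Qed.

Lemma cp_critical c : critical T (cp c).
Proof. by apply/existsP; exists c.1; rewrite /crit_pt. Qed.

Lemma cp_inj : injective cp.
Proof.
move=> [s b] [s' b']; rewrite /crit_pt /= => -[bs ->]; congr pair.
have lt (u v : 'I_r.-1) : (u < v)%N -> itm_beta T u.+1 < itm_beta T v.+1.
  move=> uv; apply: itm_beta_lt_mono; rewrite ltnS uv /=.
  by have := ltn_ord v; rewrite ltn_predRL => /ltnW.
by case: (ltngtP s s') => [/lt|/lt|/val_inj//]; rewrite bs ltxx.
Qed.

(** Weights of discontinuities outside the attractor vanish, because F does
    near such points. *)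
Lemma w_eq0 c : w c = 0.
Proof.
apply: contrapT => /[dup] wc /w_notX nX; apply: wc.
have nG : ~ germ (cp c) X by move=> /germ_sgn_in_attractor; case: nX.
have := weight_critical (cp_critical c); rewrite (F_notX nG) oppr0 if_same.
rewrite big_mkcond (sum_atoms (fun a => if a.2 == cp c then a.1 else 0)) /=.
rewrite [X in X + _]big1 ?add0r => [|o _]; last first.
  apply: big1 => t _; case: eqP => // e; exfalso; apply: nG.
  by rewrite -e; apply: zo_iter_X.
rewrite (bigD1 c) //= [X in _ + X]big1 ?addr0 => [|c' cc'].
  rewrite big_ltn ?q_gt0 //= eqxx big_nat_cond big1 ?addr0 // => i.
  rewrite andbT => hi; have := q_min nX hi.
  by case: eqP => // ->; rewrite cp_critical.
have [->|/eqP/w_notX nX'] := eqVneq (w c') 0; first by apply: big1 => i _; rewrite if_same.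
rewrite big_nat_cond big1 // => -[|i]; rewrite andbT => hi /=.
  by case: eqP => // /cp_inj e; rewrite e eqxx in cc'.
have := @q_min c' i.+1 nX' hi => /=.
by case: eqP => // ->; rewrite cp_critical.
Qed.

Lemma sum_atoms0 (G : spoint R -> bool) :
  \sum_(a <- atoms | G a.2) a.1 =
  \sum_o \sum_(0 <= t < rt o) C o t.+1 * (G (zo o |> t))%:R.
Proof.
rewrite big_mkcond (sum_atoms (fun a => if G a.2 then a.1 else 0)) /=.
rewrite [X in _ + X]big1 ?addr0 => [|c _]; last first.
  by rewrite w_eq0; apply: big1 => i _; rewrite if_same.
by apply: eq_bigr => o _; apply: eq_bigr => t _; case: ifP; rewrite ?mulr1 ?mulr0.
Qed.

(** The orbits pass through the discontinuity only once, so its weight is the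
    coefficient in force after the landing; the value of F there is its value at
    the start of the orbit. *)
Lemma coef_critical o t : (t < rt o)%N -> critical T (zo o |> t) ->
  C o t.+1 = if (zo o).2 then F (zo o) else - F (zo o).
Proof.
move=> tr /weight_critical; rewrite iter_smap_side F_orbit // => <-.
rewrite (sum_atoms0 (fun z => z == zo o |> t)) (bigD1 o) //=.
rewrite [X in _ + X]big1 ?addr0 => [|o' oo']; last first.
  rewrite big_nat_cond; apply: big1 => t' /andP[/andP[_ tr'] _].
  case: eqP => [/(orbit_uniq tr' tr)[e _]|_]; last by rewrite mulr0.
  by rewrite e eqxx in oo'.
rewrite (bigD1_seq t) ?mem_index_iota ?iota_uniq //= eqxx mulr1.
rewrite big_nat_cond big1 ?addr0 // => t' /andP[/andP[_ tr'] tt'].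
case: eqP => [/(orbit_uniq tr' tr)[_ e]|_]; last by rewrite mulr0.
by rewrite e eqxx in tt'.
Qed.

(** An atom strictly inside J h lies on an orbit of J h at time 0. *)
Lemma F_const h (u v : R) : (J h).1 <= u -> u < v -> v <= (J h).2 ->
  (forall o, home o = h -> ~ (u < (zo o).1 < v)) ->
  F (u, true) = F (v, false).
Proof.
move=> Ju uv vJ hz; apply: cum_const => // a; rewrite mem_cat.
case/orP => /allpairsPdep[x [t [_]]]; rewrite mem_iota add0n => /andP[_ tr] -> /= huv;
  last exact: w_eq0.
have hJ : sgn_in (J h) (zo x |> t) by rewrite /sgn_in; case: ifP; lra.
have [ho t0] := orbit_home hJ tr.
by exfalso; apply: (hz x ho); rewrite t0 in huv.
Qed.

(** By the f-coordinates the jump of F at x can be computed with the coefficients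
    before the landings at x instead of those after them, which covers a cut
    point that is itself a discontinuity.  At the points considered only orbits
    that start there contribute. *)
Lemma F_jump (x : R) :
  (forall b, sgn_in (J h0) (x, b) \/ ~ germ (x, b) X) ->
  F (x, true) - F (x, false) =
  \sum_(o | (home o == h0) && ((zo o).1 == x)) C o 0%N.
Proof.
move=> hx; rewrite /cumg /= cum_jump (sum_atoms0 (fun z => z.1 == x)).
have -> : \sum_o \sum_(0 <= t < rt o) C o t.+1 * ((zo o |> t).1 == x)%:R =
          \sum_o \sum_(0 <= t < rt o) C o t * ((zo o |> t).1 == x)%:R.
  apply/eqP; rewrite -subr_eq0 -sumrB.
  have := f_rel (fun y => (y == x)%:R); rewrite [X in _ + X]big1 ?addr0 => [e0|c _].
    apply/eqP; rewrite -[RHS]e0; apply: eq_bigr => o _; rewrite -sumrB.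
    by apply: eq_bigr => t _; rewrite mulrBl.
  by rewrite w_eq0 mul0r.
rewrite [RHS]big_mkcond; apply: eq_bigr => o _.
rewrite big_ltn //= [X in _ + X]big_nat_cond [X in _ + X]big1 ?addr0 => [|t].
  case: eqP => e; rewrite ?andbF ?mulr0 // mulr1 andbT; case: eqP => // ho.
  exfalso; apply: ho; case: (hx (zo o).2); rewrite -e -surjective_pairing.
    by move=> hJ; have [] := @orbit_home o 0%N h0 hJ (rt_gt0 o).
  by move=> nX; case: nX; apply: zo_X.
move=> /andP[/andP[t0 tr] _]; case: eqP => e; rewrite ?mulr0 //.
exfalso; case: (hx (zo o |> t).2); rewrite -e -surjective_pairing.
  by move=> hJ; have [_ et] := orbit_home hJ tr; rewrite et in t0.
by case; apply: zo_iter_X.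
Qed.

(** The theorem only uses these properties of F: they express every coefficient
    of the relation by values of F at germs. *)
Lemma step_function : exists F : spoint R -> R,
  [/\ forall c, w c = 0,
      forall o t, (t < rt o)%N -> critical T (zo o |> t) ->
        C o t.+1 = if (zo o).2 then F (zo o) else - F (zo o),
      forall h (u v : R), (J h).1 <= u -> u < v -> v <= (J h).2 ->
        (forall o, home o = h -> ~ (u < (zo o).1 < v)) ->
        F (u, true) = F (v, false),
      forall x : R, (forall b, sgn_in (J h0) (x, b) \/ ~ germ (x, b) X) ->
        F (x, true) - F (x, false) =
        \sum_(o | (home o == h0) && ((zo o).1 == x)) C o 0%N
    & forall z, ~ germ z X -> F z = 0].
Proof.
exists (cumg atoms); split.
- exact: w_eq0.
- exact: coef_critical.
- exact: F_const.
- exact: F_jump.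
- exact: F_notX.
Qed.

End OrbitRelation.

(** * The vectors of an orbit, summed along time *)

Section LandingSums.
Variables (R : realType) (V : lmodType R) (P : pred nat) (c : nat -> R).
Variables (g f : nat -> V).

Let L n := [seq t <- iota 0 n | P t].
(* The time 0 is put in front of the landings, so that tau n 0 is the start. *)
Let tau n k : nat := nth 0%N (0%N :: L n) k.
Let cnt t := count P (iota 0 t).
Let st n k : V := if k is k'.+1 then f (tau n k) else 0.

Lemma landingsS n : L n.+1 = if P n then rcons (L n) n else L n.
Proof. by rewrite /L -addn1 iotaD filter_cat /=; case: ifP; rewrite ?cats1 ?cats0. Qed.

Lemma size_landings n : size (L n) = cnt n.
Proof. by rewrite size_filter. Qed.

(** Summation by parts along time, cut at the landings: c k is in force from the
    k-th landing to the next one. *)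
Lemma landing_sum n :
  \sum_(0 <= k < size (L n))
     c k *: (\sum_(tau n k <= t < tau n k.+1) g t + st n k - f (tau n k.+1))
  + c (size (L n)) *: (\sum_(tau n (size (L n)) <= t < n) g t + st n (size (L n)))
  = \sum_(0 <= t < n) c (cnt t.+1) *: g t
    + \sum_(0 <= t < n) (c (cnt t.+1) - c (cnt t)) *: f t.
Proof.
elim: n => [|n IH]; first by rewrite !big_geq //= addr0 scaler0 !add0r.
have tau_le k : (tau n k <= n)%N.
  have [h|h] := ltnP k (size (0%N :: L n)); last by rewrite /tau nth_default.
  have := mem_nth 0%N h; rewrite -/(tau n k) inE => /orP[/eqP->//|].
  by rewrite mem_filter mem_iota => /andP[_ /ltnW].
rewrite ![in RHS]big_nat_recr //= addrACA -IH -!size_landings landingsS.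
case: ifP => Pn; last first.
  rewrite subrr scale0r addr0.
  have tauE k : tau n.+1 k = tau n k by rewrite /tau landingsS Pn.
  have stE k : st n.+1 k = st n k by case: k => //= k; rewrite tauE.
  rewrite tauE stE big_nat_recr //= [_ + g n + _]addrAC [c _ *: (_ + g n)]scalerDr addrA.
  by congr (_ + _ *: _ + _); apply: eq_bigr => k _; rewrite !tauE stE.
have tauE k : (k <= size (L n))%N -> tau n.+1 k = tau n k.
  by rewrite /tau landingsS Pn; case: k => //= k h; rewrite nth_rcons h.
have tauN : tau n.+1 (size (L n)).+1 = n.
  by rewrite /tau landingsS Pn /= nth_rcons ltnn eqxx.
have stE k : (k <= size (L n))%N -> st n.+1 k = st n k.
  by case: k => //= k h; rewrite tauE.
rewrite size_rcons big_nat_recr //= tauN big_nat1 tauE // stE //.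
have -> : \sum_(0 <= k < size (L n)) c k *:
     (\sum_(tau n.+1 k <= t < tau n.+1 k.+1) g t + st n.+1 k - f (tau n.+1 k.+1))
  = \sum_(0 <= k < size (L n)) c k *:
     (\sum_(tau n k <= t < tau n k.+1) g t + st n k - f (tau n k.+1)).
  apply: eq_big_nat => k /andP[_ kL].
  by rewrite !tauE // ?stE // ltnW.
rewrite -!addrA; congr (_ + _); rewrite !scalerDr scalerN scalerBl.
by rewrite -!addrA; congr (_ + (_ + _)); rewrite addrCA; congr (_ + _); rewrite addrC.
Qed.

Lemma landing_count n k : (k < size (L n))%N ->
  [/\ (nth 0 (L n) k < n)%N, P (nth 0 (L n) k)
    & cnt (nth 0%N (L n) k).+1 = k.+1].
Proof.
elim: n => [//|n IH]; rewrite landingsS.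
case: ifP => Pn; last by case/IH => h1 h2 h3; split=> //; apply: leqW.
rewrite size_rcons ltnS leq_eqVlt nth_rcons => /orP[/eqP->|kL].
  by rewrite ltnn eqxx; split=> //; rewrite -size_landings landingsS Pn size_rcons.
by rewrite kL; have [h1 h2 h3] := IH kL; split=> //; apply: leqW.
Qed.

End LandingSums.

Section OrbitVectors.
Variables (R : realType) (r : nat) (T : ITM R r).
Implicit Types (z : spoint R) (J : bounds R).

Definition e_part z : W R r := (\sum_(s < r) (sgn_in (piece T s) z)%:R *: delta_mx 0 s, 0).
Definition f_part z : W R r := (0, f_ind T z.1).

Lemma sum_fst (I : Type) (l : seq I) (p : pred I) (v : I -> 'rV[R]_r) :
  \sum_(i <- l | p i) ((v i, 0) : W R r) = (\sum_(i <- l | p i) v i, 0).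
Proof.
elim/big_rec2 : _ => // i x y _ ->.
by congr pair; rewrite /= addr0.
Qed.

Lemma e_sgn_sum z a b : (a <= b)%N ->
  (e_sgn T (iter a (itm_smap T) z) (b - a), 0)
  = \sum_(a <= t < b) e_part (iter t (itm_smap T) z) :> W R r.
Proof.
move=> ab; rewrite sum_fst; congr pair; rewrite /e_sgn exchange_big /=.
apply: eq_bigr => s _; rewrite -scaler_suml; congr (_ *: _).
rewrite /visits_sgn -sum1_count natr_sum big_mkcond /= /index_iota.
rewrite (_ : iota a (b - a) = map (addn a) (iota 0 (b - a))); last first.
  by rewrite -iotaDl addn0.
rewrite big_map; apply: eq_bigr => t _.
by rewrite addnC iterD; case: ifP.
Qed.

Lemma W_split (x : 'rV[R]_r) (y y' : 'rV[R]_r.-1) :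
  (x, y - y') = (x, 0) + (0, y) - (0, y') :> W R r.
Proof. by congr pair; rewrite /= ?addr0 ?subr0 ?add0r. Qed.

Lemma W_split0 (x : 'rV[R]_r) (y : 'rV[R]_r.-1) :
  (x, y) = (x, 0) + (0, y) :> W R r.
Proof. by congr pair; rewrite /= ?addr0 ?add0r. Qed.

Lemma W_splitN (x : 'rV[R]_r) (y : 'rV[R]_r.-1) :
  (x, - y) = (x, 0) - (0, y) :> W R r.
Proof. by congr pair; rewrite /= ?subr0 ?add0r. Qed.

(** The part of the relation that belongs to one orbit: c 0 goes with the
    landing vector, c k with the vector that starts at the k-th landing. *)
Definition orbit_vec J z (c : nat -> R) : W R r :=
  c 0%N *: Lvec_sgn T z
  + \sum_(1 <= k < nland T J z) c k *: Cvec T J z k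
  + c (nland T J z) *: Rvec T J z.

Definition n_landed z t := count (fun i => critical T (iter i (itm_smap T) z)) (iota 0 t).

Lemma n_landedS z t :
  n_landed z t.+1 = (n_landed z t + critical T (iter t (itm_smap T) z))%N.
Proof. by rewrite /n_landed -addn1 iotaD count_cat /= add0n addn0. Qed.

Lemma n_landed_return J z : n_landed z (return_sgn T J z) = nland T J z.
Proof. by rewrite /nland /landings size_filter. Qed.

Lemma first_landing J z : (0 < nland T J z)%N ->
  least [set t | critical T (iter t (itm_smap T) z)] = land_time T J z 1.
Proof.
move=> m0; rewrite /land_time /=.
have [h1 h2 h3] := landing_count m0.
apply: leastE => // t ct; rewrite leqNgt; apply/negP => lt.
have : (2 <= n_landed z (land_time T J z 1).+1)%N.
  rewrite n_landedS {2}/land_time /= h2 addn1 ltnS -has_count; apply/hasP; exists t => //.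
  by rewrite mem_iota.
by rewrite (h3 : n_landed z (land_time T J z 1).+1 = 1%N).
Qed.

(** The coefficient in force just after time t is c (n_landed z t.+1): the e-part
    collects it at every time, and the f-part collects its increments, which are
    zero except at the landings. *)
Lemma orbit_vecE J z c : (0 < nland T J z)%N ->
  orbit_vec J z c =
  \sum_(0 <= t < return_sgn T J z)
     c (n_landed z t.+1) *: e_part (iter t (itm_smap T) z)
  + \sum_(0 <= t < return_sgn T J z)
     (c (n_landed z t.+1) - c (n_landed z t)) *: f_part (iter t (itm_smap T) z).
Proof.
move=> m0; rewrite -(landing_sum (fun i => critical T (iter i (itm_smap T) z)) c
  (fun t => e_part (iter t (itm_smap T) z)) (fun t => f_part (iter t (itm_smap T) z))).
rewrite -/(landings T J z) -/(nland T J z).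
have land_lt k : (k < nland T J z)%N -> (land_time T J z k.+1 < return_sgn T J z)%N.
  by move=> km; have [] := landing_count km.
have land_le k : (k.+1 < nland T J z)%N -> (land_time T J z k.+1 <= land_time T J z k.+2)%N.
  move=> km; apply/ltnW; rewrite /land_time /=.
  apply: (sorted_ltn_nth ltn_trans 0%N) => //; rewrite ?inE; last exact: ltnW.
    by apply: sorted_filter; [exact: ltn_trans|exact: iota_ltn_sorted].
rewrite /orbit_vec (@big_ltn _ _ _ 0%N) //=; congr (_ + _ + _).
- congr (_ *: _); rewrite addr0 -e_sgn_sum // subn0 /= /Lvec_sgn W_splitN.
  by rewrite (first_landing m0).
- apply: eq_big_nat => -[//|k] /andP[_ km]; congr (_ *: _).
  by rewrite /= -e_sgn_sum ?land_le // /Cvec W_split.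
have [m mE] : exists m, nland T J z = m.+1 by exists (nland T J z).-1; rewrite prednK.
rewrite mE; congr (_ *: _); rewrite /Rvec mE W_split0 /land_pt e_sgn_sum //.
by apply/ltnW/land_lt; rewrite mE.
Qed.

End OrbitVectors.

(** * The two families of coordinates *)

Section Coordinates.
Variables (R : realType) (r : nat) (T : ITM R r).
Implicit Types (z : spoint R).

Definition e_coord (s : 'I_r) (v : W R r) : R := v.1 0 s.

(** A test function k of the position turns the f-coordinates into conditions on
    geometric points: indicators of half-lines give the transport of F, and those
    of single points give its jumps. *)
Definition f_coord (k : R -> R) (v : W R r) : R :=
  \sum_(s < r.-1) v.2 0 s * k (itm_beta T s.+1).

Lemma e_coord_linear s : scalar (e_coord s).
Proof. by move=> a u v; rewrite /e_coord /= !mxE. Qed.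

Lemma f_coord_linear k : scalar (f_coord k).
Proof.
move=> a u v; rewrite /f_coord mulr_sumr -big_split; apply: eq_bigr => s _.
by rewrite /= !mxE mulrDl mulrA.
Qed.

HB.instance Definition _ s :=
  GRing.isLinear.Build R (W R r) R *%R (e_coord s) (e_coord_linear s).
HB.instance Definition _ k :=
  GRing.isLinear.Build R (W R r) R *%R (f_coord k) (f_coord_linear k).

Lemma e_coord_e_part s z : e_coord s (e_part T z) = (sgn_in (piece T s) z)%:R.
Proof.
rewrite /e_coord /e_part /= summxE (bigD1 s) //= !mxE !eqxx mulr1 big1 ?addr0 //.
by move=> t ts; rewrite !mxE [s == t]eq_sym (negbTE ts) andbF mulr0.
Qed.

Lemma e_coord_f_part s z : e_coord s (f_part T z) = 0.
Proof. by rewrite /e_coord /= mxE. Qed.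

Lemma f_coord_e_part k z : f_coord k (e_part T z) = 0.
Proof. by rewrite /f_coord big1 // => s _; rewrite /= mxE mul0r. Qed.

Lemma f_coord_f_part k z : critical T z -> f_coord k (f_part T z) = k z.1.
Proof.
rewrite /critical /is_disc /f_coord /f_part /f_ind /ind /= => /existsP[s0 hs0].
case: pickP => [s /eqP ->|/(_ s0)]; last by rewrite hs0.
rewrite (bigD1 s) //= mxE !eqxx mul1r big1 ?addr0 // => t ts.
by rewrite mxE (negbTE ts) andbF mul0r.
Qed.

End Coordinates.

(** * Returns and cut points *)

Section Returns.
Variables (R : realType) (r : nat) (T : ITM R r).
Implicit Types (z : spoint R) (J : bounds R).

Lemma landing_return J z : (0 < nland T J z)%N ->
  [/\ (0 < return_sgn T J z)%N,
      sgn_in J (iter (return_sgn T J z) (itm_smap T) z)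
    & forall t, (0 < t < return_sgn T J z)%N ->
        ~~ sgn_in J (iter t (itm_smap T) z)].
Proof.
move=> m0; have r0 : return_sgn T J z <> 0%N.
  by move=> r0; move: m0; rewrite /nland /landings r0.
have [[h1 h2] h3] := least_neq0 r0; split=> // t /andP[t0 tr].
by apply/negP => hJ; have := h3 t (conj t0 hJ); rewrite leqNgt tr.
Qed.

Lemma same_itinerary_shift J u v t : ico J `<=` ico (whole R) ->
  same_itinerary T (ico J) -> ico J u -> ico J v ->
  iter t (itm_map T) u - u = iter t (itm_map T) v - v.
Proof.
move=> Jw it Ju Jv; elim: t => [|t IH]; first by rewrite !subrr.
have [s hs] : exists s, sgn_in (piece T s) (iter t (itm_map T) u, true).
  by apply: piece_ex; apply/ico_sgn; apply: iter_map_whole; apply: Jw.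
have hs' : sgn_in (piece T s) (iter t (itm_map T) v, true).
  by apply/ico_sgn/(it u v Ju Jv t s)/ico_sgn.
by rewrite !iterS (itm_mapE hs) (itm_mapE hs') addrAC IH addrAC.
Qed.

(** Iterating a return of u to J repeats the displacement of u, since all the
    points of J have the same itinerary; periodicity forces it to vanish. *)
Lemma periodic_return J u t : ico J `<=` ico (whole R) ->
  ico J `<=` itm_periodic T -> same_itinerary T (ico J) ->
  ico J u -> ico J (iter t (itm_map T) u) -> iter t (itm_map T) u = u.
Proof.
move=> Jw Jp it Ju Jtu; set d := iter t (itm_map T) u - u.
have step k : iter (k * t) (itm_map T) u = u + k%:R * d.
  elim: k => [|k IH]; first by rewrite mul0r addr0.
  rewrite mulSn addnC iterD.
  have := same_itinerary_shift (k * t) Jw it Jtu Ju; rewrite IH.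
  by move=> /eqP; rewrite subr_eq => /eqP ->; rewrite -natr1 /d; ring.
have [p p0 up] := Jp u Ju.
have : u + p%:R * d = u.
  rewrite -step mulnC; elim: t {Jtu d step} => //= t IH.
  by rewrite mulSn iterD IH up.
rewrite -{2}[u]addr0 => /addrI /eqP; rewrite mulf_eq0 pnatr_eq0 eqn0Ngt p0 /=.
by rewrite subr_eq0 => /eqP.
Qed.

(** The displacement of the germ z is that of the points of J near z. *)
Lemma maximal_periodic_return J z t : maximal_periodic T J ->
  sgn_in J z -> sgn_in J (iter t (itm_smap T) z) -> iter t (itm_smap T) z = z.
Proof.
move=> [_ [Jw Jp it] _] /sgn_in_germ gz gt.
have wz : sgn_in (whole R) z.
  by apply: germ_sgn_in; apply: (germ_impl _ gz) => u; apply: Jw.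
have [u [Ju [Jtu]]] := germ_and_ex gz
  (germ_and (germ_pull wz (sgn_in_germ gt)) (germ_iter T t wz)).
rewrite (periodic_return Jw Jp it Ju Jtu) => e.
have e1 : (iter t (itm_smap T) z).1 = z.1 by lra.
by rewrite [LHS]surjective_pairing e1 iter_smap_side -surjective_pairing.
Qed.

Lemma visits_right (s : 'I_r) x m : sgn_in (whole R) (x, true) ->
  visits_geo T s x m = visits_sgn T s (x, true) m.
Proof.
move=> wx; apply: eq_count => i; rewrite iter_smap_right //.
by apply/asboolP/idP => /ico_sgn.
Qed.

(** The orbit of an interior point is the orbit of its right germ, as T is
    continuous from the right. *)
Lemma Lvec_right x : sgn_in (whole R) (x, true) ->
  Lvec_geo T x = Lvec_sgn T (x, true).
Proof.
move=> wx; rewrite /Lvec_geo /Lvec_sgn.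
have -> : [set t | is_disc T (iter t (itm_map T) x)] =
          [set t | critical T (iter t (itm_smap T) (x, true))].
  by apply/seteqP; split=> t /=; rewrite iter_smap_right.
congr pair; last by rewrite iter_smap_right.
by apply: eq_bigr => s _; rewrite visits_right.
Qed.

Lemma cut_pt_lt (J : bounds R) (a : seq R) (j k : nat) :
  J.1 < J.2 -> sorted <%R a -> (forall p, p \in a -> J.1 < p < J.2) ->
  (j < k <= ncut a)%N -> cut_pt J a j < cut_pt J a k.
Proof.
move=> J12 sa ha /andP[jk kN].
have E i : cut_pt J a i = nth J.2 (J.1 :: rcons a J.2) i.
  rewrite /cut_pt; case: i => //= i; rewrite nth_rcons.
  by case: ltngtP => // [h|->]; rewrite nth_default // ltnW.
rewrite !E; apply: (sorted_ltn_nth lt_trans) => //; rewrite ?inE /= ?size_rcons //.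
  have -> : path <%R J.1 (rcons a J.2) = sorted <%R (rcons (J.1 :: a) J.2) by [].
  rewrite /= rcons_path; apply/andP; split.
    by rewrite path_min_sorted //; apply/allP => p /ha /andP[h _]; exact: h.
  have := mem_last J.1 a; rewrite inE => /orP[/eqP e|/ha /andP[]//]; by rewrite e.
by apply: leq_trans jk _; apply: leq_trans kN _.
Qed.

Lemma orbit_vec_periodic J z (x : nat -> R) : (0 < nland T J z)%N ->
  orbit_vec T J z (fun k => if k == 0%N then x (nland T J z) else x k) =
  \sum_(1 <= k < (nland T J z).+1) x k *: Cvec_per T J z k.
Proof.
move=> m0; rewrite /orbit_vec /= (gtn_eqF m0) big_nat_recr //=.
rewrite {2}/Cvec_per eqxx scalerDr addrAC addrC [_ *: Lvec_sgn _ _ + _]addrC.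
congr (_ + _).
by apply: eq_big_nat => -[//|k] /= km; rewrite /Cvec_per ltn_eqF.
Qed.

Lemma orbit_vec_component J z (x y : R) (f : nat -> R) : (0 < nland T J z)%N ->
  orbit_vec T J z
    (fun k => if k == 0%N then x else if k == nland T J z then y else f k) =
  x *: Lvec_sgn T z
  + (\sum_(1 <= k < nland T J z) f k *: Cvec T J z k + y *: Rvec T J z).
Proof.
move=> m0; rewrite /orbit_vec /= (gtn_eqF m0) eqxx -addrA; congr (_ + (_ + _)).
by apply: eq_big_nat => -[//|k] /= km; rewrite ltn_eqF.
Qed.

End Returns.

(** * The orbits of the boundary germs and of the cut points *)

Section Family.
Variables (R : realType) (r : nat) (T : ITM R r) (n : nat).
Variables (J : 'I_n.+1 -> bounds R) (a : seq R).

(** A piece is a periodic interval J_i or a part of J_0 between successive cut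
    points, and the sign true or false selects its left or right end; the right
    end of the piece j is the cut point j.+1. *)
Definition orbit_index : finType := (('I_n + 'I_(ncut a)) * bool)%type.

Definition home_of (o : orbit_index) : 'I_n.+1 :=
  if o.1 is inl i then lift ord0 i else ord0.

Definition start_of (o : orbit_index) : spoint R :=
  match o.1, o.2 with
  | inl i, true => lbound_pt (J (lift ord0 i))
  | inl i, false => rbound_pt (J (lift ord0 i))
  | inr j, true => cut_p (J ord0) a j
  | inr j, false => cut_m (J ord0) a j.+1
  end.

Lemma sum_orbit_index (V : lmodType R) (G : orbit_index -> V) :
  \sum_o G o = \sum_(i < n) G (inl i, true) + \sum_(i < n) G (inl i, false)
    + \sum_(j < ncut a) G (inr j, true) + \sum_(j < ncut a) G (inr j, false).
Proof.
transitivity (\sum_(x : 'I_n + 'I_(ncut a)) \sum_(b : bool) G (x, b)).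
  by rewrite pair_bigA; apply: eq_bigr => -[].
rewrite (eq_bigr _ (fun x _ => big_bool _ (fun b => G (x, b)))) big_sumType.
by rewrite !big_split /= !addrA.
Qed.

Variables (al alRp alRm : nat -> R) (alCp alCm : nat -> nat -> R).
Variables (alPp alPm : 'I_n -> nat -> R).

(** For a periodic interval the landing vector is part of the last vector of the
    orbit, hence the value at k = 0.  The landing vector of an interior cut point
    is shared by its two germs and is attached to the right one. *)
Definition coef (o : orbit_index) (k : nat) : R :=
  let m := nland T (J (home_of o)) (start_of o) in
  match o.1, o.2 with
  | inl i, true => if k == 0%N then alPp i m else alPp i k
  | inl i, false => if k == 0%N then alPm i m else alPm i k
  | inr j, true => if k == 0%N then al j else if k == m then alRp j else alCp j k
  | inr j, false =>
      if k == 0%N then if j.+1 == ncut a then al (ncut a) else 0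
      else if k == m then alRm j.+1 else alCm j.+1 k
  end.

Hypothesis nland_gt0 : forall o,
  (0 < nland T (J (home_of o)) (start_of o))%N.
Hypothesis cut_whole : forall j : 'I_(ncut a),
  sgn_in (whole R) (cut_p (J ord0) a j).

Lemma sum_Lvec :
  \sum_(0 <= j < (ncut a).+1) al j *: Lvec T (J ord0) a j =
  \sum_(j < ncut a) al j *: Lvec_sgn T (cut_p (J ord0) a j)
  + \sum_(j < ncut a) (if j.+1 == ncut a then al (ncut a) else 0)
      *: Lvec_sgn T (cut_m (J ord0) a j.+1).
Proof.
rewrite big_nat_recr //= big_mkord; congr (_ + _).
  apply: eq_bigr => j _.
  by rewrite /Lvec ltn_ord (Lvec_right T (cut_whole j)) if_same.
rewrite [RHS](bigD1 ord_max) //= eqxx big1 ?addr0; last first.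
  move=> j; rewrite -val_eqE /= => /negbTE jN.
  by rewrite eqSS jN scale0r.
by rewrite /Lvec /= ltnn.
Qed.

Lemma relation_orbits :
  \sum_o orbit_vec T (J (home_of o)) (start_of o) (coef o) =
     \sum_(i < n)
       \sum_(1 <= k < (nland T (J (lift ord0 i))
                         (lbound_pt (J (lift ord0 i)))).+1)
         alPp i k *: Cvec_per T (J (lift ord0 i))
                       (lbound_pt (J (lift ord0 i))) k
   + \sum_(i < n)
       \sum_(1 <= k < (nland T (J (lift ord0 i))
                         (rbound_pt (J (lift ord0 i)))).+1)
         alPm i k *: Cvec_per T (J (lift ord0 i))
                       (rbound_pt (J (lift ord0 i))) k
   + \sum_(0 <= j < ncut a)
       (\sum_(1 <= k < nland T (J ord0) (cut_p (J ord0) a j))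
          alCp j k *: Cvec T (J ord0) (cut_p (J ord0) a j) k
        + alRp j *: Rvec T (J ord0) (cut_p (J ord0) a j))
   + \sum_(1 <= j < (ncut a).+1)
       (\sum_(1 <= k < nland T (J ord0) (cut_m (J ord0) a j))
          alCm j k *: Cvec T (J ord0) (cut_m (J ord0) a j) k
        + alRm j *: Rvec T (J ord0) (cut_m (J ord0) a j))
   + \sum_(0 <= j < (ncut a).+1) al j *: Lvec T (J ord0) a j.
Proof.
rewrite sum_Lvec sum_orbit_index big_add1 !big_mkord /=.
under eq_bigr => i _ do rewrite (orbit_vec_periodic _ (nland_gt0 (inl i, true))).
under [X in _ + X + _ + _]eq_bigr => i _ do
  rewrite (orbit_vec_periodic _ (nland_gt0 (inl i, false))).
under [X in _ + _ + X + _]eq_bigr => j _ do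
  rewrite (orbit_vec_component _ _ _ (nland_gt0 (inr j, true))).
under [X in _ + _ + _ + X]eq_bigr => j _ do
  rewrite (orbit_vec_component _ _ _ (nland_gt0 (inr j, false))).
rewrite !big_split /= -!addrA; congr (_ + (_ + _)).
set L1 := \sum_j al _ *: _; set L2 := \sum_j (if _ then _ else _) *: _.
rewrite addrC -!addrA; congr (_ + (_ + _)).
by rewrite addrCA addrC addrA [LHS]addrC -!addrA [L2 + _]addrC -!addrA.
Qed.

End Family.

(** * Solutions of a relation *)

Unset Implicit Arguments.

Theorem theorem4p6 (R : realType) (r : nat) (hr : (2 <= r)%N) (T : ITM R r)
  (n : nat) (J : 'I_n.+1 -> bounds R)
  (hX : forall i : 'I_n.+1, ico (J i) `<=` attractor T)
  (hdisj : trivIset setT (fun i : 'I_n.+1 => set_orbit T (ico (J i))))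
  (hJ0 : component_ico (attractor T) (J ord0))
  (hper : forall i : 'I_n, maximal_periodic T (J (lift ord0 i)))
  (hbd : forall i : 'I_n.+1,
     (0 < nland T (J i) (lbound_pt (J i)))%N /\
     (0 < nland T (J i) (rbound_pt (J i)))%N)
  (a : seq R) (ha : cut_points T (J ord0) a)
  (hp2 : forall j : nat, (0 <= j <= ncut a - 1)%N ->
     (2 <= nland T (J ord0) (cut_p (J ord0) a j))%N)
  (hm2 : forall j : nat, (1 <= j <= ncut a)%N ->
     (2 <= nland T (J ord0) (cut_m (J ord0) a j))%N)
  (al : nat -> R) (alRp alRm : nat -> R) (alCp alCm : nat -> nat -> R)
  (alPp alPm : 'I_n -> nat -> R) (alB : 'I_r.-1 * bool -> R)
  (hrel :
     \sum_(i < n)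
       \sum_(1 <= k < (nland T (J (lift ord0 i))
                         (lbound_pt (J (lift ord0 i)))).+1)
         alPp i k *: Cvec_per T (J (lift ord0 i))
                       (lbound_pt (J (lift ord0 i))) k
   + \sum_(i < n)
       \sum_(1 <= k < (nland T (J (lift ord0 i))
                         (rbound_pt (J (lift ord0 i)))).+1)
         alPm i k *: Cvec_per T (J (lift ord0 i))
                       (rbound_pt (J (lift ord0 i))) k
   + \sum_(0 <= j < ncut a)
       (\sum_(1 <= k < nland T (J ord0) (cut_p (J ord0) a j))
          alCp j k *: Cvec T (J ord0) (cut_p (J ord0) a j) k
        + alRp j *: Rvec T (J ord0) (cut_p (J ord0) a j))
   + \sum_(1 <= j < (ncut a).+1)
       (\sum_(1 <= k < nland T (J ord0) (cut_m (J ord0) a j))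
          alCm j k *: Cvec T (J ord0) (cut_m (J ord0) a j) k
        + alRm j *: Rvec T (J ord0) (cut_m (J ord0) a j))
   + \sum_(0 <= j < (ncut a).+1) al j *: Lvec T (J ord0) a j
   + \sum_(c | `[< crit_notX T c >]) alB c *: Cvec_crit T c
   = 0 :> W R r) :
  [/\ forall i : 'I_n,
        (forall k : nat,
           (1 <= k <= nland T (J (lift ord0 i))
                        (lbound_pt (J (lift ord0 i))))%N ->
           alPp i k = alPp i 1%N) /\
        (forall k : nat,
           (1 <= k <= nland T (J (lift ord0 i))
                        (rbound_pt (J (lift ord0 i))))%N ->
           - alPm i k = alPp i 1%N),
      forall j : nat, (0 <= j <= ncut a - 1)%N ->
        [/\ forall k : nat,
              (1 <= k <= nland T (J ord0) (cut_p (J ord0) a j) - 1)%N ->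
              alCp j k = alRp j,
            forall k : nat,
              (1 <= k <= nland T (J ord0) (cut_m (J ord0) a j.+1) - 1)%N ->
              - alCm j.+1 k = alRp j
          & - alRm j.+1 = alRp j],
      [/\ al 0%N = alCp 0%N 1%N,
          al (ncut a) = alCm (ncut a) 1%N
        & forall j : nat, (1 <= j <= ncut a - 1)%N ->
            al j = alCp j 1%N + alCm j 1%N]
    & forall c : 'I_r.-1 * bool, crit_notX T c -> alB c = 0].
Proof.
have Jlt i : (J i).1 < (J i).2.
  have [->|[i' ->]] : i = ord0 \/ exists i', i = lift ord0 i'.
    by case: (unliftP ord0 i) => [i' ->|->]; [right; exists i'|left].
    by case: hJ0.
  by case: (hper i').
have sa : sorted <%R a by case: ha.
have ain p : p \in a -> (J ord0).1 < p < (J ord0).2.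
  by case: ha => _ h /h [].
(* The cut points, with the ends of J_0. *)
pose x j := cut_pt (J ord0) a j.
have x0 : x 0%N = (J ord0).1 by [].
have xN : x (ncut a) = (J ord0).2 by rewrite /x /cut_pt /ncut nth_default.
have xlt j k : (j < k <= ncut a)%N -> x j < x k by apply: cut_pt_lt.
have xle j k : (j <= k <= ncut a)%N -> x j <= x k.
  move=> /andP[]; rewrite leq_eqVlt => /orP[/eqP->//|jk kN].
  by apply/ltW/xlt; rewrite jk.
have xlo j : (j <= ncut a)%N -> (J ord0).1 <= x j by move=> jN; rewrite -x0 xle.
have xhi j : (j <= ncut a)%N -> x j <= (J ord0).2 by move=> jN; rewrite -xN xle ?jN /=.
pose O := @orbit_index R n a.
pose home : O -> 'I_n.+1 := @home_of R n a.
pose zo : O -> spoint R := @start_of R n J a.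
have zo_home o : sgn_in (J (home o)) (zo o).
  case: o => -[i|j] [] /=; rewrite /zo /start_of /sgn_in /= ?lexx ?Jlt //.
    have jN := ltn_ord j.
    by rewrite -/(x j) xlo ?(ltnW jN) //= -xN xlt // jN leqnn.
  have jN := ltn_ord j.
  by rewrite -/(x j.+1) xhi // andbT -x0 xlt.
have m_gt0 (o : O) : (0 < nland T (J (home o)) (zo o))%N.
  case: o => -[i|j] [] /=; rewrite /zo /start_of /home /home_of /=.
  - by case: (hbd (lift ord0 i)).
  - by case: (hbd (lift ord0 i)).
  - by apply/ltnW/hp2; have := ltn_ord j; rewrite /ncut; lia.
  by apply/ltnW/hm2; have := ltn_ord j; lia.
pose rt o := return_sgn T (J (home o)) (zo o).
pose C (o : O) t := coef T J al alRp alRm alCp alCm alPp alPm o (n_landed T (zo o) t).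
pose w c := if `[< crit_notX T c >] then alB c else 0.
pose q c := least [set t | (0 < t)%N /\
  critical T (iter t (itm_smap T) (crit_pt T c))].
have zo_whole o : sgn_in (whole R) (zo o).
  apply: germ_sgn_in; apply: (germ_impl _ (sgn_in_germ (zo_home o))) => u Ju.
  exact: (attractor_whole (hX _ _ Ju)).
have qP c : crit_notX T c -> [/\ (0 < q c)%N,
    critical T (iter (q c) (itm_smap T) (crit_pt T c))
  & forall i, (0 < i < q c)%N -> ~~ critical T (iter i (itm_smap T) (crit_pt T c))].
  move=> [[k k0 kc] _]; have [[h1 h2] h3] := @least_min [set t | (0 < t)%N /\
    critical T (iter t (itm_smap T) (crit_pt T c))] k (conj k0 kc).
  split=> // i /andP[i0 iq]; apply/negP => ic.
  by have := h3 i (conj i0 ic); rewrite leqNgt iq.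
have wP c : w c <> 0 -> crit_notX T c.
  by rewrite /w; case: asboolP.
(* The relation, rewritten as sums along the orbits and seen through a linear
   form. *)
have rel (ell : {scalar W R r}) :
    \sum_o (\sum_(0 <= t < rt o)
               C o t.+1 * ell (e_part T (iter t (itm_smap T) (zo o)))
            + \sum_(0 <= t < rt o)
               (C o t.+1 - C o t) * ell (f_part T (iter t (itm_smap T) (zo o))))
    + \sum_c w c * ell (Cvec_crit T c) = 0.
  rewrite -[RHS](linear0 ell) -hrel -relation_orbits //; last first.
    by move=> j; apply: (zo_whole (inr j, true)).
  rewrite linearD !linear_sum; congr (_ + _).
    apply: eq_bigr => o _; rewrite orbit_vecE // linearD !linear_sum.
    by congr (_ + _); apply: eq_bigr => t _; rewrite linearZ.
  rewrite [RHS]big_mkcond; apply: eq_bigr => c _.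
  by rewrite /w; case: ifP; rewrite ?mul0r // linearZ.
have CvecE c : crit_notX T c -> Cvec_crit T c =
    \sum_(0 <= i < q c) e_part T (iter i (itm_smap T) (crit_pt T c))
    + f_part T (crit_pt T c) - f_part T (iter (q c) (itm_smap T) (crit_pt T c)).
  by move=> _; rewrite /Cvec_crit W_split -e_sgn_sum // subn0.
have e_rel (s : 'I_r) :
    \sum_o \sum_(0 <= t < rt o)
       C o t.+1 * (sgn_in (piece T s) (iter t (itm_smap T) (zo o)))%:R
    + \sum_c \sum_(0 <= i < q c)
       w c * (sgn_in (piece T s) (iter i (itm_smap T) (crit_pt T c)))%:R = 0.
  rewrite -[RHS](rel (e_coord s)); congr (_ + _);
    [apply: eq_bigr => o _ /=|apply: eq_bigr => c _ /=].
    rewrite [X in _ + X]big1 ?addr0 => [|t _]; last by rewrite e_coord_f_part mulr0.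
    by apply: eq_bigr => t _; rewrite e_coord_e_part.
  have [->|/eqP/wP nX] := eqVneq (w c) 0.
    by rewrite mul0r big1 // => i _; rewrite mul0r.
  rewrite CvecE // linearB linearD /= !e_coord_f_part subr0 addr0 linear_sum mulr_sumr.
  by apply: eq_bigr => i _; rewrite /= e_coord_e_part.
have f_rel (k : R -> R) :
    \sum_o \sum_(0 <= t < rt o)
       (C o t.+1 - C o t) * k (iter t (itm_smap T) (zo o)).1
    + \sum_c w c * (k (crit_pt T c).1
                    - k (iter (q c) (itm_smap T) (crit_pt T c)).1) = 0.
  rewrite -[RHS](rel (f_coord T k)); congr (_ + _);
    [apply: eq_bigr => o _ /=|apply: eq_bigr => c _ /=].
    rewrite [X in X + _]big1 ?add0r => [|t _]; last by rewrite f_coord_e_part mulr0.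
    apply: eq_bigr => t _.
    have [ct|nct] := boolP (critical T (iter t (itm_smap T) (zo o))).
      by rewrite f_coord_f_part.
    by rewrite /C n_landedS (negbTE nct) addn0 subrr !mul0r.
  have [->|/eqP/wP nX] := eqVneq (w c) 0; first by rewrite !mul0r.
  have [_ qc _] := qP c nX.
  rewrite CvecE // linearB linearD /= linear_sum /= big1 ?add0r => [|i _].
    by rewrite !f_coord_f_part // cp_critical.
  exact: f_coord_e_part.
have [|||||||F [Fw Fcoef Fconst Fjump FnX]] :=
  @step_function _ _ T _ _ ord0 J hX hdisj home zo rt C zo_home _ _ _ _ _ w q wP _ _
    e_rel f_rel.
- by move=> o t; case: (landing_return (m_gt0 o)) => _ _; apply.
- by move=> o; case: (landing_return (m_gt0 o)).
- by move=> o; case: (landing_return (m_gt0 o)).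
- move=> [[i|j] b] [[i'|j'] b']; rewrite /home /home_of /=.
  + move=> /lift_inj <-; case: b; case: b' => //.
  + by move=> e; have := neq_lift ord0 i; rewrite e eqxx.
  + by move=> e; have := neq_lift ord0 i'; rewrite -e eqxx.
  have jN := ltn_ord j; have jN' := ltn_ord j'.
  move=> _; case: b; case: b' => //; rewrite /zo /start_of /= => -[];
    rewrite -/(x _) -/(x _) => e; congr (inr _, _); apply/val_inj.
    case: (ltngtP j j') => // h.
      by have := xlt j j'; rewrite h (ltnW jN') e ltxx => /(_ isT).
    by have := xlt j' j; rewrite h (ltnW jN) e ltxx => /(_ isT).
  case: (ltngtP j j') => // h.
    by have := xlt j.+1 j'.+1; rewrite ltnS h jN' e ltxx => /(_ isT).
  by have := xlt j'.+1 j.+1; rewrite ltnS h jN e ltxx => /(_ isT).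
- move=> [[i|j] b] // _.
  have per := hper i; have [_ hin _] := landing_return (m_gt0 (inl i, b)).
  split; first exact: (maximal_periodic_return per (zo_home (inl i, b)) hin).
  rewrite /C n_landed_return /coef /= /n_landed /=.
  by have := m_gt0 (inl i, b); case: b {hin}; rewrite /home /home_of /zo /= => /gtn_eqF ->.
- by move=> c /qP[].
- by move=> c i /qP[_ _ qmin]; apply: qmin.
(* The k-th landing happens at a time t with n_landed t.+1 = k. *)
have coefF (o : O) k : (1 <= k <= nland T (J (home o)) (zo o))%N ->
    coef T J al alRp alRm alCp alCm alPp alPm o k
    = if (zo o).2 then F (zo o) else - F (zo o).
  case: k => // k /= km; have [h1 h2 h3] := landing_count km.
  by rewrite -(Fcoef o _ h1 h2) /C -[k.+1]h3.
have Fper (i : 'I_n) : F (zo (inl i, true)) = F (zo (inl i, false)).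
  apply: (Fconst (lift ord0 i) _ _ (lexx _) (Jlt _) (lexx _)).
  move=> [[i'|j'] b] e; last by have := neq_lift ord0 i; rewrite -e eqxx.
  by move: e => /lift_inj ->; case: b; rewrite /zo /start_of /=; lra.
have Fcut (j : 'I_(ncut a)) : F (zo (inr j, true)) = F (zo (inr j, false)).
  have jN := ltn_ord j.
  apply: (Fconst ord0); rewrite -/(x _) -?/(x _.+1).
  - by rewrite xlo // ltnW.
  - by rewrite xlt // leqnn.
  - exact: xhi.
  move=> [[i'|j'] b] e; 
    first by have := neq_lift ord0 i'; rewrite (e : lift ord0 i' = ord0) eqxx.
  have between k : (k <= ncut a)%N -> ~ (x j < x k < x j.+1).
    move=> kN /andP[h1 h2]; have [kj|jk] := leqP k j.
      by have := xle k j; rewrite kj (ltnW jN) => /(_ isT); rewrite leNgt h1.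
    by have := xle j.+1 k; rewrite jk kN => /(_ isT); rewrite leNgt h2.
  have jN' := ltn_ord j'.
  by case: b {e}; rewrite /zo /start_of /=; apply: between => //; apply: ltnW.
(* An outer germ at an end of J_0 is not in X, as J_0 is maximal. *)
have Fleft : F (x 0%N, false) = 0 by apply/FnX/component_left.
have Fright : F (x (ncut a), true) = 0 by rewrite xN; apply/FnX/component_right.
(* The coefficient of the landing vector at the cut point j is attached to the
   right germ, except for j = ncut a, where only the left germ is a boundary. *)
have jump j : (j <= ncut a)%N -> al j = F (x j, true) - F (x j, false).
  move=> jN; rewrite Fjump; last first.
    move=> [].
      have [->|jneN] := eqVneq j (ncut a); first by right; rewrite xN; apply: component_right.
      left; rewrite /sgn_in /= xlo //= -xN xlt // leqnn andbT.
      by rewrite ltn_neqAle jneN.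
    have [->|j0] := eqVneq j 0%N; first by right; apply: component_left.
    left; rewrite /sgn_in /= xhi // andbT -x0 xlt // jN andbT.
    by rewrite lt0n.
  have xinj k : (k <= ncut a)%N -> x k = x j -> k = j.
    move=> kN e; case: (ltngtP k j) => // h.
      by have := xlt k j; rewrite h jN e ltxx => /(_ isT).
    by have := xlt j k; rewrite h kN e ltxx => /(_ isT).
  have [ejN|jneN] := eqVneq j (ncut a).
    rewrite (bigD1 (inr ord_max, false)) /=; last first.
      by rewrite /home /home_of /zo /start_of /= -/(x _) ejN ?eqxx.
    rewrite big1 ?addr0 => [|[[i'|k] b]].
    - by rewrite /C /coef /n_landed /= eqxx ejN.
    - by rewrite /home /home_of /=.
    have kN := ltn_ord k.
    case: b; rewrite /home /home_of /zo /start_of /= -/(x _) => /andP[/eqP e ne].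
      by have := kN; rewrite (xinj k (ltnW kN) e) ejN ltnn.
    exfalso; move: ne; rewrite xpair_eqE andbT => /negP; apply; apply/eqP.
    congr inr; apply/val_inj => /=; have := xinj k.+1 kN e; rewrite ejN.
    by move=> [].
  have jltN : (j < ncut a)%N by rewrite ltn_neqAle jneN.
  rewrite (bigD1 (inr (Ordinal jltN), true)) /=; last first.
    by rewrite /home /home_of /zo /start_of /= -/(x _) ?eqxx.
  rewrite big1 ?addr0 => [|[[i'|k] b]].
  - by rewrite /C /coef /n_landed /=.
  - by rewrite /home /home_of /=.
  have kN := ltn_ord k.
  case: b; rewrite /home /home_of /zo /start_of /= -/(x _) => /andP[/eqP e ne].
    exfalso; move: ne; rewrite xpair_eqE andbT => /negP; apply; apply/eqP.
    by congr inr; apply/val_inj => /=; apply: xinj => //; apply: ltnW.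
  rewrite /C /coef /n_landed /=; case: eqP => // kE; move: jneN.
  by rewrite -(xinj k.+1 kN e) kE eqxx.
have Np j (jN : (j < ncut a)%N) : (1 < nland T (J ord0) (cut_p (J ord0) a j))%N.
  by apply: hp2; move: jN; rewrite /ncut; lia.
have Nm j (jN : (j < ncut a)%N) : (1 < nland T (J ord0) (cut_m (J ord0) a j.+1))%N.
  exact: hm2.
have valCp j (jN : (j < ncut a)%N) k :
    (1 <= k <= nland T (J ord0) (cut_p (J ord0) a j) - 1)%N ->
    alCp j k = F (x j, true).
  move=> /andP[k1 km]; have m1 := Np j jN.
  have km' : (k < nland T (J ord0) (cut_p (J ord0) a j))%N by lia.
  have := coefF (inr (Ordinal jN), true) k; rewrite k1 (ltnW km') => /(_ isT).
  by rewrite /coef /= gtn_eqF // ltn_eqF.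
have valRp j (jN : (j < ncut a)%N) : alRp j = F (x j, true).
  have m1 := Np j jN.
  have := coefF (inr (Ordinal jN), true) (nland T (J ord0) (cut_p (J ord0) a j)).
  by rewrite (ltnW m1) leqnn => /(_ isT); rewrite /coef /= eqxx gtn_eqF // ltnW.
have valCm j (jN : (j < ncut a)%N) k :
    (1 <= k <= nland T (J ord0) (cut_m (J ord0) a j.+1) - 1)%N ->
    alCm j.+1 k = - F (x j.+1, false).
  move=> /andP[k1 km]; have m1 := Nm j jN.
  have km' : (k < nland T (J ord0) (cut_m (J ord0) a j.+1))%N by lia.
  have := coefF (inr (Ordinal jN), false) k; rewrite k1 (ltnW km') => /(_ isT).
  by rewrite /coef /= gtn_eqF // ltn_eqF.
have valRm j (jN : (j < ncut a)%N) : alRm j.+1 = - F (x j.+1, false).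
  have m1 := Nm j jN.
  have := coefF (inr (Ordinal jN), false) (nland T (J ord0) (cut_m (J ord0) a j.+1)).
  by rewrite (ltnW m1) leqnn => /(_ isT); rewrite /coef /= eqxx gtn_eqF // ltnW.
have cut_const j (jN : (j < ncut a)%N) : F (x j, true) = F (x j.+1, false).
  exact: (Fcut (Ordinal jN)).
have NE j : (j <= ncut a - 1)%N -> (j < ncut a)%N by rewrite /ncut; lia.
split.
- move=> i; have valP k : (1 <= k <= nland T (J (lift ord0 i))
      (lbound_pt (J (lift ord0 i))))%N -> alPp i k = F (zo (inl i, true)).
    by move=> hk; have := coefF (inl i, true) k hk; rewrite /coef /=; case: k hk.
  have valM k : (1 <= k <= nland T (J (lift ord0 i))
      (rbound_pt (J (lift ord0 i))))%N -> alPm i k = - F (zo (inl i, false)).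
    by move=> hk; have := coefF (inl i, false) k hk; rewrite /coef /=; case: k hk.
  have h1 := m_gt0 (inl i, true).
  by split=> k hk; rewrite [RHS]valP // ?valP // valM // opprK Fper.
- move=> j /andP[_ /NE jN]; split=> [k hk|k hk|].
  + by rewrite valCp // valRp.
  + by rewrite valCm // valRp // opprK cut_const.
  by rewrite valRm // valRp // opprK cut_const.
- have N0 : (0 < ncut a)%N by [].
  have one_p j (jN : (j < ncut a)%N) : alCp j 1%N = F (x j, true).
    by apply: valCp => //; have := Np j jN; lia.
  have one_m j (jN : (j < ncut a)%N) : alCm j.+1 1%N = - F (x j.+1, false).
    by apply: valCm => //; have := Nm j jN; lia.
  split.
  + by rewrite jump // one_p // Fleft subr0.
  + by rewrite jump // Fright sub0r; apply/esym/one_m.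
  move=> [//|j] /andP[_ /NE jN]; rewrite jump ?(ltnW jN) // one_p // one_m //.
  exact: ltnW.
move=> c hc; have := Fw c; rewrite /w; case: asboolP => //.
Qed.
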